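(* Let $m\ge 2$ be an integer and let $T_m$ be the map on $I=[0,1]$ described in the context. Let $\mu$ be a probability measure on the Borel $\sigma$-algebra of $I$ which is absolutely continuous with respect to Lebesgue measure, with distribution function $F_0(x)=\mu([0,x])$ and density $F_0'$. Put $c_m=\frac{(m-1)^2}{\log\left(m^2/(2m-1)\right)}$. (i) If $F_0'$ is Riemann integrable, then for every $x\in I$ $$\lim_{n\to\infty}\mu\left(T_m^n<x\right)=\frac{c_m}{(m-1)^2}\log\frac{m((m-1)x+1)}{(m-1)x+m}.$$ (ii) If $F_0'$ is a Lipschitz function, then there exist two positive constants $q<1$ and $k$ such that for all $x\in I$ and $n\in\mathbf{N}_+$ $$\mu\left(T_m^n<x\right)=\frac{c_m}{(m-1)^2}\,(1+\theta q^n)\log\frac{m((m-1)x+1)}{(m-1)x+m},$$ where $\theta=\theta(\mu,n,x)$ satisfies $|\theta|\le k$.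
   Context: Fix an integer $m\ge 2$. For $x\in(0,1]$ let $a_1(x)=\left\lfloor \frac{\log x^{-1}}{\log m}\right\rfloor\in\mathbf{N}=\{0,1,2,\dots\}$, and define $T_m:I\to I$ by $T_m(0)=0$ and, for $x\neq 0$, $$T_m(x)=\frac{m^{\frac{\log x^{-1}}{\log m}-\left\lfloor\frac{\log x^{-1}}{\log m}\right\rfloor}-1}{m-1},$$ equivalently $x=\frac{m^{-a_1(x)}}{1+(m-1)T_m(x)}$. This is the shift map of the continued fraction expansion $x=\cfrac{m^{-a_1}}{1+\cfrac{(m-1)m^{-a_2}}{1+\cdots}}$ with $a_n(x)=a_1(T_m^{n-1}(x))$. $T_m^n$ denotes the $n$-th iterate and $\mu(T_m^n<x)=\mu(\{t\in I: T_m^n(t)<x\})$. $\mathbf{N}_+=\{1,2,\dots\}$. *)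

(* Defs.v *)
From HB Require Import structures.
From mathcomp Require Import all_boot all_order all_algebra.
From mathcomp Require Import all_classical all_reals all_analysis.

Set Implicit Arguments.
Unset Strict Implicit.
Unset Printing Implicit Defensive.

Import Order.TTheory GRing.Theory Num.Theory.
Import numFieldNormedType.Exports.

Local Open Scope classical_set_scope.
Local Open Scope ring_scope.

Section ContinuedFraction.
Context {R : realType}.
Implicit Types (m n : nat) (x : R).

Definition cf_log m x : R := ln x^-1 / ln m%:R.

Definition cf_digit m x : int := Num.floor (cf_log m x).

(* Only the values on the unit interval, which is mapped into itself, matter. *)
Definition cf_shift m x : R :=
  if x == 0 then 0
  else (m%:R `^ (cf_log m x - (cf_digit m x)%:~R) - 1) / (m%:R - 1).

Definition cf_const m : R :=
  (m%:R - 1) ^+ 2 / ln (m%:R ^+ 2 / (2 * m%:R - 1)).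

Definition cf_event m n x : set R :=
  [set t | t \in `[0, 1] /\ iter n (cf_shift m) t < x].

End ContinuedFraction.

Section Density.
Context {R : realType}.

(* A probability on the Borel sets of [0, 1] is represented by a probability
   on the Borel sets of R that gives mass 1 to [0, 1]. *)
Definition distr_fun (mu : probability (measurableTypeR R) R) (x : R) : R :=
  fine (mu [set` `[0, x]]).

(* The distribution function of an absolutely continuous probability is in
   general differentiable only almost everywhere; [f] is a version of its
   derivative, hence of the density. *)
Definition distr_deriv (mu : probability (measurableTypeR R) R) (f : R -> R) :
    Prop :=
  {ae @lebesgue_measure R, forall x : R, x \in `]0, 1[ ->
     is_derive x 1 (distr_fun mu) (f x)}.

(* Convergence of the Riemann sums over tagged partitions
   a = p 0 <= t 0 <= p 1 <= ... <= t (N - 1) <= p N = b as the mesh goes to 0. *)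
Definition riemann_integrable (a b : R) (f : R -> R) : Prop :=
  exists l : R, forall e : R, 0 < e -> exists2 d : R, 0 < d &
    forall (N : nat) (p t : nat -> R), p 0%N = a -> p N = b ->
      (forall i, (i < N)%N -> p i <= t i <= p i.+1 /\ p i.+1 - p i < d) ->
      `| \sum_(0 <= i < N) f (t i) * (p i.+1 - p i) - l | < e.

End Density.

(* Main.v *)
(** With [b = m] and [weight x = 1 + (b - 1) x], the inverse branches of [T_m]
    are [u_i x = b^-i / weight x].  Hence the distribution functions
    [F_n x = mu (T_m^n < x)] satisfy [F_(n+1) = transfer F_n], where
    [transfer F x = \sum_i (F (u_i 0) - F (u_i x))], and the limit law is a fixed
    point of [transfer].  In the coordinate [ln weight] the branches contract by
    the factor [(b - 1) / b] and their Jacobians have logarithmic derivatives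
    bounded by 2, so [transfer] maps the cone of distributions whose density has
    its logarithmic derivative bounded by [k = 3 (N + 1)], where [b <= N + 1],
    into the cone with constant [k - 1].  The slack allows a fixed fraction of
    the mass to be removed at each step as a multiple of the limit law; the
    remaining mass decays geometrically and its density stays comparable to
    its mass.  A distribution with Lipschitz density is a difference of two
    members of the cone, which gives (ii).  For (i), [transfer] preserves mass
    and order, and a Riemann integrable density is approximated from below in
    L^1 by step functions, themselves approximated by Lipschitz functions. *)

Require Import Defs.
From HB Require Import structures.
From mathcomp Require Import all_boot all_order all_algebra.
From mathcomp Require Import all_classical all_reals all_analysis.
From mathcomp Require Import measurable_realfun.
From mathcomp Require Import ring lra.

Set Implicit Arguments.
Unset Strict Implicit.
Unset Printing Implicit Defensive.

Import Order.TTheory GRing.Theory Num.Theory.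
Import numFieldNormedType.Exports.

Local Open Scope classical_set_scope.
Local Open Scope ring_scope.

(** The quotient [(t + c) ^+ k / t] has logarithmic derivative [k / (t + c) - 1 / t], nonnegative as
    soon as [t + c <= k t]. Differentiation is replaced by Bernoulli's inequality for
    [1 + (y - x) / (x + c)], cleared of denominators. *)
Lemma mul_expr_Bernoulli {R : realDomainType} (x y c : R) (k : nat) :
  0 < x -> x <= y -> 0 <= c -> x + c <= k%:R * x ->
  y * (x + c) ^+ k <= x * (y + c) ^+ k.
Proof.
move=> x0 xy c0 xck.
have xc0 : 0 < x + c by lra.
suff H n : n%:R * (y - x) * (x + c) ^+ n + (x + c) * (x + c) ^+ n
     <= (x + c) * (y + c) ^+ n.
  have {}H := H k; rewrite -(ler_pM2l xc0).
  have p0 : 0 <= (x + c) ^+ k by rewrite exprn_ge0 // ltW.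
  apply: (@le_trans _ _ (x * (k%:R * (y - x) * (x + c) ^+ k + (x + c) * (x + c) ^+ k))); last first.
    by rewrite mulrCA ler_pM2l.
  rewrite -subr_ge0.
  have -> : x * (k%:R * (y - x) * (x + c) ^+ k + (x + c) * (x + c) ^+ k) -
    (x + c) * (y * (x + c) ^+ k) = (k%:R * x - (x + c)) * (y - x) * (x + c) ^+ k by ring.
  by rewrite !mulr_ge0 //; lra.
elim: n => [|n IH]; first by rewrite !expr0; lra.
have p0 : 0 <= (x + c) ^+ n by rewrite exprn_ge0 // ltW.
have yc0 : 0 <= y + c by lra.
apply: (@le_trans _ _ ((y + c) * (n%:R * (y - x) * (x + c) ^+ n + (x + c) * (x + c) ^+ n))); last first.
  by rewrite exprS mulrCA ler_wpM2l.
rewrite -subr_ge0 !exprS -natr1.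
have -> : (y + c) * (n%:R * (y - x) * (x + c) ^+ n + (x + c) * (x + c) ^+ n) -
   ((n%:R + 1) * (y - x) * ((x + c) * (x + c) ^+ n) + (x + c) * ((x + c) * (x + c) ^+ n))
  = n%:R * (y - x) ^+ 2 * (x + c) ^+ n by ring.
by apply: mulr_ge0 => //; apply: mulr_ge0 => //; exact: sqr_ge0.
Qed.

(** * The transfer operator on distribution functions *)

Section Transfer.
Context {R : realType} (b : R) (b_gt1 : 1 < b).
Implicit Types (F G : R -> R) (x y a c : R).

Definition weight x : R := 1 + (b - 1) * x.

Definition branch (i : nat) x : R := b ^- i / weight x.

(* If [F] is the distribution function of a point [t], then [transfer F] is that
   of its image under [T_m]. *)
Definition transfer F x : R :=
  limn (series (fun i => F (branch i 0) - F (branch i x))).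

Definition unit_lipschitz (K : R) F : Prop :=
  forall a c, 0 <= a -> a <= c -> c <= 1 -> `|F c - F a| <= K * (c - a).

Definition unit_homo F : Prop :=
  forall a c, 0 <= a -> a <= c -> c <= 1 -> F a <= F c.

Let b_gt0 : 0 < b. Proof. exact: lt_trans b_gt1. Qed.

Let b1_ge0 : 0 <= b - 1. Proof. by rewrite subr_ge0 ltW. Qed.

Lemma weight_ge1 x : 0 <= x -> 1 <= weight x.
Proof. by move=> x0; rewrite /weight lerDl mulr_ge0. Qed.

Lemma weight_gt0 x : 0 <= x -> 0 < weight x.
Proof. by move=> /weight_ge1; apply: lt_le_trans. Qed.

Lemma weight_homo x y : x <= y -> weight x <= weight y.
Proof. by move=> xy; rewrite /weight lerD2l ler_wpM2l. Qed.

Lemma weight0 : weight 0 = 1.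
Proof. by rewrite /weight mulr0 addr0. Qed.

Lemma weight1 : weight 1 = b.
Proof. by rewrite /weight mulr1 addrC subrK. Qed.

Lemma expVn_gt0 i : 0 < b ^- i.
Proof. by rewrite invr_gt0 exprn_gt0. Qed.

Lemma expVn_le1 i : b ^- i <= 1.
Proof. by rewrite invf_le1 ?exprn_gt0 // exprn_ege1 // ltW. Qed.

Lemma branch0 i : branch i 0 = b ^- i.
Proof. by rewrite /branch weight0 divr1. Qed.

Lemma branch1 i : branch i 1 = b ^- i.+1.
Proof. by rewrite /branch weight1 exprS invfM mulrC. Qed.

Lemma branch_ge0 i x : 0 <= x -> 0 <= branch i x.
Proof. by move=> x0; rewrite divr_ge0 // ltW ?expVn_gt0 ?weight_gt0. Qed.

Lemma branch_le1 i x : 0 <= x -> branch i x <= 1.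
Proof.
move=> x0; rewrite ler_pdivrMr ?weight_gt0 // mul1r.
exact: le_trans (expVn_le1 i) (weight_ge1 x0).
Qed.

Lemma branchB i a c : 0 <= a -> 0 <= c ->
  branch i a - branch i c = b ^- i * (b - 1) * (c - a) / (weight a * weight c).
Proof.
move=> a0 c0; rewrite /branch.
have := weight_gt0 a0; have := weight_gt0 c0; have := expVn_gt0 i.
move: (b ^- i) => B B0; rewrite /weight => wc wa.
by field; rewrite !gt_eqF.
Qed.

Lemma branch_anti i a c : 0 <= a -> a <= c -> branch i c <= branch i a.
Proof.
move=> a0 ac; rewrite ler_pM2l ?expVn_gt0 // lef_pV2 ?posrE ?weight_gt0 //.
  exact: weight_homo.
exact: le_trans ac.
Qed.

Lemma branchB_le i a c : 0 <= a -> a <= c ->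
  branch i a - branch i c <= (b - 1) * (c - a) * b ^- i.
Proof.
move=> a0 ac; have c0 := le_trans a0 ac.
rewrite branchB // ler_pdivrMr ?mulr_gt0 ?weight_gt0 //.
have w1 : 1 <= weight a * weight c by rewrite mulr_ege1 ?weight_ge1.
rewrite -[X in X <= _]mulr1 [X in X * 1](_ : _ = (b - 1) * (c - a) * b ^- i); last by ring.
by rewrite ler_wpM2l // !mulr_ge0 ?(ltW (expVn_gt0 _)) // subr_ge0.
Qed.

Lemma invb_norm : `|b^-1| < 1.
Proof. by rewrite gtr0_norm ?invr_gt0 // invf_lt1. Qed.

(** The branch images shrink like [b ^- i], so the series defining [transfer] is dominated by a
    geometric one. *)
Lemma unit_lipschitz_branch K F i a c : unit_lipschitz K F ->
  0 <= a -> a <= c ->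
  `|F (branch i a) - F (branch i c)| <= geometric (K * ((b - 1) * (c - a))) b^-1 i.
Proof.
move=> lipF a0 ac; have c0 := le_trans a0 ac.
have K0 : 0 <= K.
  have := lipF 0 1 (lexx _) ler01 (lexx _); rewrite subr0 mulr1.
  exact: le_trans.
apply: le_trans (lipF _ _ (branch_ge0 i c0) (branch_anti i a0 ac) (branch_le1 i a0)) _.
by rewrite /geometric /= -mulrA ler_wpM2l // exprVn; exact: branchB_le.
Qed.

Lemma is_cvg_branch_series K F a c : unit_lipschitz K F -> 0 <= a -> a <= c ->
  cvgn (series (fun i => F (branch i a) - F (branch i c))).
Proof.
move=> lipF a0 ac; apply: normed_cvg.
apply: (@series_le_cvg _ _ (geometric (K * ((b - 1) * (c - a))) b^-1)).
- by move=> n; exact: normr_ge0.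
- by move=> n; apply: le_trans (unit_lipschitz_branch n lipF a0 ac).
- by move=> n; exact: unit_lipschitz_branch.
- exact/is_cvg_geometric_series/invb_norm.
Qed.

Lemma transfer_cvg K F x : unit_lipschitz K F -> 0 <= x ->
  series (fun i => F (branch i 0) - F (branch i x)) @ \oo --> transfer F x.
Proof. by move=> lipF x0; exact: (is_cvg_branch_series lipF). Qed.

Lemma transferB_cvg K F a c : unit_lipschitz K F -> 0 <= a -> 0 <= c ->
  series (fun i => F (branch i a) - F (branch i c)) @ \oo -->
    transfer F c - transfer F a.
Proof.
move=> lipF a0 c0.
rewrite (_ : series _ = series (fun i => F (branch i 0) - F (branch i c)) -
  series (fun i => F (branch i 0) - F (branch i a))).
  by apply: cvgB; exact: transfer_cvg lipF _.
apply/funext => n; rewrite fctE /series /= -sumrB; apply: eq_bigr => i _; ring.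
Qed.

(** The geometric bounds sum to [K (b - 1) / (1 - b^-1) = K b]. This constant grows under iteration;
    decay rates come from the cone below. *)
Lemma transfer_lipschitz K F :
  unit_lipschitz K F -> unit_lipschitz (K * b) (transfer F).
Proof.
move=> lipF a c a0 ac c1.
have geo : series (geometric (K * ((b - 1) * (c - a))) b^-1) @ \oo --> K * b * (c - a).
  have -> : K * b * (c - a) = K * ((b - 1) * (c - a)) / (1 - b^-1).
    by field; rewrite !gt_eqF // subr_gt0.
  exact: cvg_geometric_series invb_norm.
apply: (ler_cvg_to (cvg_norm (transferB_cvg lipF a0 (le_trans a0 ac))) geo).
near=> n.
rewrite (le_trans (ler_norm_sum _ _ _)) //.
by apply: ler_sum => i _; exact: unit_lipschitz_branch.
Unshelve. all: by end_near. Qed.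

Lemma transfer_homo K F :
  unit_lipschitz K F -> unit_homo F -> unit_homo (transfer F).
Proof.
move=> lipF homoF a c a0 ac c1; rewrite -subr_ge0.
apply: (ler_cvg_to (cvg_cst 0) (transferB_cvg lipF a0 (le_trans a0 ac))).
near=> n.
apply: sumr_ge0 => i _; rewrite subr_ge0.
by apply: homoF; rewrite ?branch_ge0 ?branch_le1 ?branch_anti // (le_trans a0).
Unshelve. all: by end_near. Qed.

Lemma unit_lipschitz_cvg K F (u : R ^nat) :
  unit_lipschitz K F -> (forall n, 0 <= u n <= 1) -> u @ \oo --> 0 ->
  F \o u @ \oo --> F 0.
Proof.
move=> lipF u01 u0.
have Ku : (K * u n) @[n --> \oo] --> 0 by rewrite -(mulr0 K); exact: cvgMl_tmp.
apply/cvgrPdist_le => e e0; near=> n.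
rewrite distrC; have /andP[un0 un1] := u01 n.
apply: le_trans (lipF _ _ (lexx _) un0 un1) _; rewrite subr0.
apply: le_trans (ler_norm _) _.
rewrite -normrN -[- _]add0r.
by near: n; exact: cvgr_dist_le.
Unshelve. all: by end_near. Qed.

Lemma cvg_expVn : (b ^- n) @[n --> \oo] --> 0.
Proof.
by under eq_fun do rewrite -exprVn; exact: cvg_expr invb_norm.
Qed.

Lemma transfer0 F : transfer F 0 = 0.
Proof.
rewrite /transfer (_ : series _ = cst 0); first exact: lim_cst.
by apply/funext => n; rewrite /series /=; apply: big1 => i _; rewrite subrr.
Qed.

(** The images of [[0, 1]] under the branches are the adjacent cells [[b ^- i.+1, b ^- i]], so the
    series telescopes. Together with [transfer0] this is conservation of mass. *)
Lemma transfer1 K F : unit_lipschitz K F -> transfer F 1 = F 1 - F 0.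
Proof.
move=> lipF; apply: (cvg_unique _ (transfer_cvg lipF ler01)) => //.
have -> : series (fun i => F (branch i 0) - F (branch i 1)) =
    (fun n => F 1 - F (b ^- n)).
  apply/funext => n; elim: n => [|n IH].
    by rewrite /series /= big_geq // expr0 invr1 subrr.
  rewrite seriesSr IH branch0 branch1; ring.
apply: cvgB; first exact: cvg_cst.
apply: (unit_lipschitz_cvg lipF) cvg_expVn => n.
by rewrite expVn_le1 ltW // expVn_gt0.
Qed.

Lemma transfer_lin K K' F G (e : R) x :
  unit_lipschitz K F -> unit_lipschitz K' G -> 0 <= x ->
  transfer (fun t => F t + e * G t) x = transfer F x + e * transfer G x.
Proof.
move=> lipF lipG x0; apply: cvg_lim => //.
rewrite (_ : series _ = (fun n => series (fun i => F (branch i 0) - F (branch i x)) n +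
  e * series (fun i => G (branch i 0) - G (branch i x)) n)).
  apply: cvgD; first exact: transfer_cvg lipF _.
  by apply: cvgMl_tmp; exact: transfer_cvg lipG _.
apply/funext => n; rewrite /series /= mulr_sumr -big_split /=.
by apply: eq_bigr => i _; ring.
Qed.

Lemma transfer_ext F G x : (forall t, 0 <= t <= 1 -> F t = G t) -> 0 <= x ->
  transfer F x = transfer G x.
Proof.
move=> FG x0; congr (limn (series _)); apply/funext => i.
by rewrite !FG // branch_ge0 ?branch_le1.
Qed.

Lemma unit_lipschitz_lin K K' F G (e : R) :
  unit_lipschitz K F -> unit_lipschitz K' G ->
  unit_lipschitz (K + `|e| * K') (fun t => F t + e * G t).
Proof.
move=> lipF lipG a c a0 ac c1.
have -> : F c + e * G c - (F a + e * G a) = (F c - F a) + e * (G c - G a) by ring.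
rewrite (le_trans (ler_normD _ _)) // mulrDl lerD ?lipF // normrM -mulrA.
by rewrite ler_wpM2l // lipG.
Qed.

End Transfer.

(** Mean value bound for a power in algebraic form, applied in [in_cone_sub] to powers of the
    weights. *)
Lemma ler_subXX {R : realDomainType} (x y : R) (n : nat) :
  0 <= x -> x <= y -> y ^+ n.+1 - x ^+ n.+1 <= n.+1%:R * (y - x) * y ^+ n.
Proof.
move=> x0 xy; elim: n => [|n IH]; first by rewrite !expr1 expr0; lra.
have y0 := le_trans x0 xy.
have xyn : x ^+ n.+1 * (y - x) <= y ^+ n.+1 * (y - x).
  by rewrite ler_wpM2r ?subr_ge0 // lerXn2r.
have yIH := ler_wpM2l y0 IH.
have -> : y ^+ n.+2 - x ^+ n.+2 = y * (y ^+ n.+1 - x ^+ n.+1) + x ^+ n.+1 * (y - x).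
  by rewrite [y ^+ n.+2]exprS [x ^+ n.+2]exprS; ring.
apply: le_trans (lerD yIH xyn) _.
rewrite le_eqVlt -(natr1 n.+1) [y ^+ n.+1]exprS; apply/orP; left; apply/eqP; ring.
Qed.

(** * The cone of distributions and its image under [transfer] *)

Section Cone.
Context {R : realType} (b : R) (b_gt1 : 1 < b).
Implicit Types (F G : R -> R) (x y a c : R).
Local Notation weight := (weight b).
Local Notation branch := (branch b).
Local Notation transfer := (transfer b).

Let b_gt0 : 0 < b. Proof. exact: lt_trans b_gt1. Qed.

Let b1_gt0 : 0 < b - 1. Proof. by rewrite subr_gt0. Qed.

(* If [F] has a density [f], membership means that [f * weight ^+ k] is
   nondecreasing and [f / weight ^+ k] is nonincreasing; expressing it with
   slopes of [F] avoids differentiating the series defining [transfer]. *)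
Definition in_cone (k : nat) F : Prop :=
  unit_homo F /\
  forall x y a c a' c', 0 <= x -> y <= 1 ->
    x <= a -> a <= c -> c <= y -> x <= a' -> a' <= c' -> c' <= y ->
    (F c - F a) * (c' - a') * weight x ^+ k
      <= (F c' - F a') * (c - a) * weight y ^+ k.

(** Comparison with the mean slope over the whole interval, on which [weight] runs from 1 to [b]. *)
Lemma in_cone_upper k F a c : in_cone k F -> 0 <= a -> a <= c -> c <= 1 ->
  F c - F a <= b ^+ k * (F 1 - F 0) * (c - a).
Proof.
move=> [_ coneF] a0 ac c1.
have := coneF 0 1 a c 0 1 (lexx _) (lexx _) a0 ac c1 (lexx _) ler01 (lexx _).
by rewrite weight0 weight1 expr1n !mulr1 subr0 mulr1; nra.
Qed.

Lemma in_cone_lower k F a c : in_cone k F -> 0 <= a -> a <= c -> c <= 1 ->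
  (F 1 - F 0) * (c - a) <= b ^+ k * (F c - F a).
Proof.
move=> [_ coneF] a0 ac c1.
have := coneF 0 1 0 1 a c (lexx _) (lexx _) (lexx _) ler01 (lexx _) a0 ac c1.
by rewrite weight0 weight1 expr1n !mulr1 subr0 mulr1; nra.
Qed.

Lemma in_cone_lipschitz k F :
  in_cone k F -> unit_lipschitz (b ^+ k * (F 1 - F 0)) F.
Proof.
move=> coneF a c a0 ac c1; have [homoF _] := coneF.
by rewrite ger0_norm ?subr_ge0 ?homoF // in_cone_upper.
Qed.

(** With [p = b ^- i * (b - 1)], the branch [i] turns a weight [w] into [(w + p) / w]. Monotonicity
    of [(w + p) ^+ N.+1 / w] lowers the exponent from [N.+1 * j] to [N * j], and the Jacobian,
    [p / w ^+ 2] up to sign, adds 2. *)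
Lemma in_cone_transfer (N j : nat) F : b <= N.+1%:R ->
  in_cone (N.+1 * j) F -> in_cone (N * j + 2) (transfer F).
Proof.
move=> bN coneF; have lipF := in_cone_lipschitz coneF.
have [homoF ineqF] := coneF.
split=> [|x y a c a' c' x0 y1 xa ac cy xa' ac' cy'].
  exact: transfer_homo lipF homoF.
have a0 := le_trans x0 xa; have c0 := le_trans a0 ac.
have a0' := le_trans x0 xa'; have c0' := le_trans a0' ac'.
have xy : x <= y by rewrite (le_trans xa) // (le_trans ac).
have y0 := le_trans x0 xy.
have termwise i : (F (branch i a) - F (branch i c)) * (c' - a') * weight x ^+ (N * j + 2)
    <= (F (branch i a') - F (branch i c')) * (c - a) * weight y ^+ (N * j + 2).
  (* The branches reverse the order: [branch i y] is the lower end, and each pair of endpoints is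
     exchanged. *)
  have := ineqF _ _ _ _ _ _ (branch_ge0 b_gt1 i y0) (branch_le1 b_gt1 i x0)
   (branch_anti b_gt1 i c0 cy) (branch_anti b_gt1 i a0 ac) (branch_anti b_gt1 i x0 xa)
   (branch_anti b_gt1 i c0' cy') (branch_anti b_gt1 i a0' ac') (branch_anti b_gt1 i x0 xa').
  set X := F _ - F _; set Y := F (branch i a') - F _.
  rewrite !branchB //.
  set p := b ^- i * (b - 1).
  have p0 : 0 < p by rewrite mulr_gt0 ?expVn_gt0.
  have pN : p <= N%:R.
    rewrite /p -[N%:R]mul1r ler_pM ?(ltW (expVn_gt0 b_gt1 i)) ?expVn_le1 ?(ltW b1_gt0) //.
    by rewrite lerBlDr natr1.
  have X0 : 0 <= X.
    by rewrite subr_ge0 homoF ?branch_ge0 ?branch_le1 ?branch_anti.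
  have Y0 : 0 <= Y.
    by rewrite subr_ge0 homoF ?branch_ge0 ?branch_le1 ?branch_anti.
  have wE z : 0 <= z -> weight (branch i z) = (weight z + p) / weight z.
    move=> z0; have w0 := weight_gt0 b_gt1 z0.
    have -> : weight (branch i z) = 1 + p / weight z.
      by rewrite /p [b ^- i * _]mulrC -mulrA.
    by field; rewrite gt_eqF.
  rewrite !wE // !expr_div_n.
  have wx1 := weight_ge1 b_gt1 x0.
  have wx0 := weight_gt0 b_gt1 x0; have wy0 := weight_gt0 b_gt1 y0.
  have := weight_homo b_gt1 xa'; have := weight_homo b_gt1 cy'.
  have := weight_homo b_gt1 xa; have := weight_homo b_gt1 cy.
  have := weight_homo b_gt1 ac; have := weight_homo b_gt1 ac'.
  have wxy := weight_homo b_gt1 xy.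
  move: (weight a) (weight c) (weight a') (weight c') (weight x) (weight y)
    wx1 wx0 wy0 wxy => A C A' C' U V U1 U0 V0 UV AC' AC CV UA CV' UA'.
  (* After cancellation this is the [j]-th power of [mul_expr_Bernoulli] with exponent [N.+1]; its
     hypothesis [U + p <= N.+1 * U] follows from [p <= N] and [1 <= U]. *)
  have key : ((U + p) ^+ (N.+1 * j) / U ^+ (N.+1 * j)) * U ^+ (N * j) <=
             ((V + p) ^+ (N.+1 * j) / V ^+ (N.+1 * j)) * V ^+ (N * j).
    rewrite mulSn !exprD !invfM -!mulrA !mulVf ?expf_neq0 ?gt_eqF // !mulr1.
    rewrite !mulrA -!exprD -mulSn !exprM -!expr_div_n lerXn2r ?nnegrE ?divr_ge0 ?exprn_ge0 //; try lra.
    have := @mul_expr_Bernoulli _ U V p N.+1 U0 UV (ltW p0).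
    have -> : U + p <= N.+1%:R * U by rewrite -natr1; nra.
    move=> /(_ isT) H.
    by rewrite ler_pdivrMr // mulrAC ler_pdivlMr // mulrC [X in _ <= X]mulrC.
  move: key; set Hi := _ / U ^+ _; set Lo := _ / V ^+ _ => key.
  have Lo0 : 0 < Lo by rewrite divr_gt0 ?exprn_gt0 //; lra.
  set d := c - a; set d' := c' - a' => H.
  have d0 : 0 <= d by rewrite subr_ge0.
  have d0' : 0 <= d' by rewrite subr_ge0.
  have A0 : 0 < A by lra. have C0 : 0 < C by lra.
  have A0' : 0 < A' by lra. have C0' : 0 < C' by lra.
  have {}H : X * d' * (A * C) * Lo <= Y * d * (A' * C') * Hi.
    rewrite -(ler_pM2r p0) -(@ler_pM2r _ ((A * C * (A' * C'))^-1)) ?invr_gt0 ?mulr_gt0 //.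
    have -> : X * d' * (A * C) * Lo * p / (A * C * (A' * C')) = X * (p * d' / (A' * C')) * Lo.
      by field; rewrite !gt_eqF.
    have -> : Y * d * (A' * C') * Hi * p / (A * C * (A' * C')) = Y * (p * d / (A * C)) * Hi.
      by field; rewrite !gt_eqF.
    exact: H.
  have UN : 0 <= U ^+ (N * j) by rewrite exprn_ge0 // ltW.
  have VN : 0 <= V ^+ (N * j) by rewrite exprn_ge0 // ltW.
  have Xd : 0 <= X * d' by rewrite mulr_ge0.
  have Yd : 0 <= Y * d by rewrite mulr_ge0.
  (* The two additional powers of the weight absorb the Jacobians, by [U ^+ 2 <= A * C] on the left
     and [A' * C' <= V ^+ 2] on the right; [key] accounts for the rest. *)
  rewrite -(ler_pM2r Lo0) !exprD.
  apply: (@le_trans _ _ (X * d' * (A * C) * Lo * U ^+ (N * j))).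
    rewrite -subr_ge0.
    have -> : X * d' * (A * C) * Lo * U ^+ (N * j) - X * d' * (U ^+ (N * j) * U ^+ 2) * Lo =
      X * d' * U ^+ (N * j) * Lo * (A * C - U ^+ 2) by ring.
    have ACU : 0 <= A * C - U ^+ 2 by rewrite subr_ge0 expr2 ler_pM //; lra.
    exact: mulr_ge0 (mulr_ge0 (mulr_ge0 Xd UN) (ltW Lo0)) ACU.
  apply: (le_trans (ler_wpM2r UN H)).
  apply: (@le_trans _ _ (Y * d * (A' * C') * (Lo * V ^+ (N * j)))).
    rewrite -[X in X <= _]mulrA; apply: ler_wpM2l key; apply: mulr_ge0 => //.
    by apply: mulr_ge0; exact: ltW.
  rewrite -subr_ge0.
  have -> : Y * d * (V ^+ (N * j) * V ^+ 2) * Lo - Y * d * (A' * C') * (Lo * V ^+ (N * j)) =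
    Y * d * V ^+ (N * j) * Lo * (V ^+ 2 - A' * C') by ring.
  have L0 := ltW Lo0.
  have ACV : 0 <= V ^+ 2 - A' * C' by rewrite subr_ge0 expr2 ler_pM //; lra.
  exact: mulr_ge0 (mulr_ge0 (mulr_ge0 Yd VN) L0) ACV.
rewrite -!mulrA; apply: (ler_cvg_to (cvgMr_tmp (transferB_cvg b_gt1 lipF a0 c0))
  (cvgMr_tmp (transferB_cvg b_gt1 lipF a0' c0'))); near=> n.
rewrite /series /= !mulr_suml; apply: ler_sum => i _.
by rewrite !mulrA; exact: termwise.
Unshelve. all: by end_near. Qed.

End Cone.

(** * Subtracting a multiple of a reference distribution inside the cone *)

Section Contraction.
Context {R : realType} (b : R) (b_gt1 : 1 < b).
Implicit Types (F G : R -> R) (x y a c : R).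
Local Notation weight := (weight b).
Local Notation in_cone := (in_cone b).

Let b_gt0 : 0 < b. Proof. exact: lt_trans b_gt1. Qed.

(** The factor [b ^+ k.+2] bounds the ratio of slopes between a member of the cone with constant 2
    and one of the cone with constant [k], at equal mass; [k.+3] is the margin that [in_cone_sub]
    requires. *)
Definition gap (k : nat) : R := (k.+3%:R * b ^+ k.+2)^-1.

Lemma gap_gt0 k : 0 < gap k.
Proof. by rewrite invr_gt0 mulr_gt0 // exprn_gt0. Qed.

Lemma gap_lt1 k : gap k < 1.
Proof.
have p0 : 0 < k.+3%:R * b ^+ k.+2 by rewrite mulr_gt0 // exprn_gt0.
rewrite invf_lt1 //; apply: (@lt_le_trans _ _ k.+3%:R); first by rewrite ltr1n.
by rewrite ler_peMr // exprn_ege1 // ltW.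
Qed.

(** For densities [f], [g] and derivatives in the coordinate [ln weight], [|f'| <= k f] and
    [|g'| <= 2 g] give [|(f - e g)'| <= k f + 2 e g]. This is at most [(k + 1) (f - e g)] exactly
    when [(k + 3) e g <= f], which the choice of [gap] guarantees. *)
Lemma in_cone_sub k F G : in_cone k F -> in_cone 2 G -> G 1 - G 0 = 1 ->
  in_cone k.+1 (fun t => F t + - (gap k * (F 1 - F 0)) * G t).
Proof.
move=> coneF coneG G1; have [homoF ineqF] := coneF; have [homoG ineqG] := coneG.
have M0 : 0 <= F 1 - F 0 by rewrite subr_ge0 homoF.
have gap0 := gap_gt0 k.
(* The domination [(k + 3) e g <= f] for increments: [G] has slopes at most [b ^+ 2], and [F] slopes
   at least its mass divided by [b ^+ k]. *)
have ctrl a c : 0 <= a -> a <= c -> c <= 1 ->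
    k.+3%:R * gap k * (F 1 - F 0) * (G c - G a) <= F c - F a.
  move=> a0 ac c1; have bk0 : 0 < b ^+ k by rewrite exprn_gt0.
  have := in_cone_upper coneG a0 ac c1; rewrite G1 mulr1 => Gup.
  have Flow := in_cone_lower coneF a0 ac c1.
  have -> : k.+3%:R * gap k * (F 1 - F 0) * (G c - G a) =
      (F 1 - F 0) * (G c - G a) / b ^+ k.+2.
    by rewrite /gap; field; rewrite expf_neq0 ?gt_eqF.
  rewrite ler_pdivrMr ?exprn_gt0 // -addn2 exprD.
  apply: (le_trans (ler_wpM2l M0 Gup)).
  have -> : (F 1 - F 0) * (b ^+ 2 * (c - a)) = b ^+ 2 * ((F 1 - F 0) * (c - a)) by ring.
  have -> : (F c - F a) * (b ^+ k * b ^+ 2) = b ^+ 2 * (b ^+ k * (F c - F a)) by ring.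
  by rewrite ler_wpM2l // exprn_ge0 // ltW.
split=> [a c a0 ac c1|x y a c a' c' x0 y1 xa ac cy xa' ac' cy'].
  rewrite -subr_ge0.
  have -> : F c + - (gap k * (F 1 - F 0)) * G c - (F a + - (gap k * (F 1 - F 0)) * G a)
    = F c - F a - gap k * (F 1 - F 0) * (G c - G a) by ring.
  rewrite subr_ge0; apply: le_trans (ctrl a c a0 ac c1).
  have Gac : 0 <= G c - G a by rewrite subr_ge0 homoG.
  rewrite -!(mulrA k.+3%:R) -[X in X <= _]mul1r; apply: ler_wpM2r.
    by rewrite mulr_ge0 // mulr_ge0 // ltW.
  by rewrite ler1n.
have a0' := le_trans x0 xa'; have c1' := le_trans cy' y1.
have xy : x <= y by rewrite (le_trans xa) // (le_trans ac).
have y0 := le_trans x0 xy.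
have Hi := ctrl _ _ a0' ac' c1'.
have {}ineqF := ineqF _ _ _ _ _ _ x0 y1 xa ac cy xa' ac' cy'.
(* [G] is subtracted, so its cone inequality is taken with the two intervals exchanged. *)
have {}ineqG := ineqG _ _ _ _ _ _ x0 y1 xa' ac' cy' xa ac cy.
have wxy := weight_homo b_gt1 xy; have wx0 := weight_gt0 b_gt1 x0.
have wy0 := weight_gt0 b_gt1 y0.
move: (weight x) (weight y) wxy wx0 wy0 ineqF ineqG => U V UV U0 V0 ineqF ineqG.
set e := gap k * _.
have e0 : 0 <= e by rewrite mulr_ge0 // ltW.
have -> : (F c + - e * G c - (F a + - e * G a)) = (F c - F a) - e * (G c - G a) by ring.
have -> : (F c' + - e * G c' - (F a' + - e * G a')) = (F c' - F a') - e * (G c' - G a') by ring.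
have Gac' : 0 <= G c' - G a' by rewrite subr_ge0 homoG.
move: ineqF ineqG Hi Gac'; rewrite -!(mulrA k.+3%:R) -/e.
move: (F c - F a) (F c' - F a') (G c - G a) (G c' - G a') => f f' g g' ineqF ineqG Hi g0.
have d0 : 0 <= c - a by rewrite subr_ge0.
have d0' : 0 <= c' - a' by rewrite subr_ge0.
move: (c - a) (c' - a') d0 d0' ineqF ineqG => d d' d0 d0' ineqF ineqG.
have Uk : 0 <= U ^+ k.+1 by rewrite exprn_ge0 // ltW.
have subX : V ^+ k.+3 - U ^+ k.+3 <= k.+3%:R * (V - U) * V ^+ k.+2.
  by apply: ler_subXX => //; exact: ltW.
have s1 := ler_wpM2r (ltW U0) ineqF.
have s2 := ler_wpM2l (mulr_ge0 e0 Uk) ineqG.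
have s3 := ler_wpM2l (mulr_ge0 (mulr_ge0 e0 g0) d0) subX.
have V2k : 0 <= d * (V - U) * V ^+ k.+2.
  by apply: mulr_ge0; [rewrite mulr_ge0 ?subr_ge0|rewrite exprn_ge0 // ltW].
have s4 := ler_wpM2r V2k Hi.
(* The factor [V ^+ 2] matches the inequality for [G]. What remains is [e * g' * (V ^+ k.+3 - U ^+
   k.+3) <= f' * (V - U) * V ^+ k.+2], up to the factor [d]: the bound on powers followed by the
   domination. *)
rewrite -(@ler_pM2r _ (V ^+ 2)) ?exprn_gt0 //.
have V2 : 0 <= V ^+ 2 by rewrite exprn_ge0 // ltW.
have {}s1 := ler_wpM2r V2 s1.
move: s1 s2 s3 s4; rewrite !exprS expr0 !mulr1.
move: (U ^+ k) (V ^+ k) => P Q; clear; lra.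
Qed.
End Contraction.

(** * Iterates of the transfer operator *)

Section Iteration.
Context {R : realType} (b : R) (b_gt1 : 1 < b).
Implicit Types (F G : R -> R) (x y a c : R).
Local Notation weight := (weight b).
Local Notation transfer := (transfer b).
Local Notation in_cone := (in_cone b).
Local Notation gap := (gap b).

Let b_gt0 : 0 < b. Proof. exact: lt_trans b_gt1. Qed.

Let b1_gt0 : 0 < b - 1. Proof. by rewrite subr_gt0. Qed.

Lemma iter_transfer_lipschitz K F n :
  unit_lipschitz K F -> unit_lipschitz (K * b ^+ n) (iter n transfer F).
Proof.
move=> lipF; elim: n => [|n IH]; first by rewrite expr0 mulr1.
by rewrite exprSr mulrA; exact: transfer_lipschitz.
Qed.

Lemma iter_transfer_homo K F n :
  unit_lipschitz K F -> unit_homo F -> unit_homo (iter n transfer F).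
Proof.
move=> lipF homoF; elim: n => [//|n IH].
exact: transfer_homo (iter_transfer_lipschitz n lipF) IH.
Qed.

Lemma iter_transfer_mass K F n : unit_lipschitz K F ->
  iter n transfer F 1 - iter n transfer F 0 = F 1 - F 0.
Proof.
move=> lipF; elim: n => [//|n IH].
rewrite !iterS transfer0 subr0.
by rewrite (transfer1 b_gt1 (iter_transfer_lipschitz n lipF)).
Qed.

Lemma iter_transfer_lin K K' F G (e : R) n x :
  unit_lipschitz K F -> unit_lipschitz K' G -> 0 <= x <= 1 ->
  iter n transfer (fun t => F t + e * G t) x =
    iter n transfer F x + e * iter n transfer G x.
Proof.
move=> lipF lipG; elim: n x => [//|n IH] x /andP[x0 x1].
rewrite !iterS (transfer_ext b_gt1 IH x0).
exact: transfer_lin (iter_transfer_lipschitz n lipF) (iter_transfer_lipschitz n lipG) x0.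
Qed.

Lemma iter_transfer_ext F G n x : (forall t, 0 <= t <= 1 -> F t = G t) ->
  0 <= x <= 1 -> iter n transfer F x = iter n transfer G x.
Proof.
move=> FG; elim: n x => [|n IH] x /andP[x0 x1]; first by rewrite /= FG ?x0.
exact: transfer_ext IH x0.
Qed.

Lemma in_cone_ext k F G : (forall t, 0 <= t <= 1 -> F t = G t) ->
  in_cone k F -> in_cone k G.
Proof.
move=> FG [homoF ineqF]; split=> [a c a0 ac c1|x y a c a' c' x0 y1 xa ac cy xa' ac' cy'].
  by rewrite -!FG ?a0 ?c1 ?(le_trans a0 ac) ?(le_trans ac c1) // homoF.
have a0 := le_trans x0 xa; have a0' := le_trans x0 xa'.
have c1 := le_trans cy y1; have c1' := le_trans cy' y1.
rewrite -!FG ?a0 ?a0' ?c1 ?c1' ?(le_trans a0 ac) ?(le_trans ac c1)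
  ?(le_trans a0' ac') ?(le_trans ac' c1') //.
exact: ineqF.
Qed.

(** * Geometric convergence to an invariant distribution *)

Section Gauss.
Variables (N : nat) (G : R -> R).
Hypothesis bN : b <= N.+1%:R.
Hypothesis coneG : in_cone 2 G.
Hypothesis massG : G 1 - G 0 = 1.
Hypothesis fixG : forall x, 0 <= x <= 1 -> transfer G x = G x.

Local Notation k := (N * 3 + 2)%N.
Local Notation q := (1 - gap k).

(* One application of [transfer] leaves enough room in the cone to subtract
   the fraction [gap k] of the invariant distribution. *)
Lemma in_cone_iter_sub F n : in_cone (N.+1 * 3) F ->
  in_cone (N.+1 * 3)
    (fun t => iter n transfer F t + - ((F 1 - F 0) * (1 - q ^+ n)) * G t).
Proof.
move=> coneF; have lipF := in_cone_lipschitz coneF.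
have lipG := in_cone_lipschitz coneG.
elim: n => [|n IH].
  by apply: in_cone_ext coneF => t _; rewrite expr0 subrr mulr0 oppr0 mul0r addr0.
have coneT := in_cone_transfer b_gt1 bN IH.
have := in_cone_sub b_gt1 coneT coneG massG.
(* The exponent gained by [transfer] is spent on the subtraction, so the cone stays the same; 3 is
   the least [j] with [N * j + 2 < N.+1 * j]. *)
rewrite (_ : (N * 3 + 2).+1 = N.+1 * 3)%N; last by rewrite -addnS mulSnr.
have lipT := iter_transfer_lipschitz n lipF.
rewrite (transfer1 b_gt1 (unit_lipschitz_lin _ lipT lipG)) transfer0 subr0.
have -> : iter n transfer F 1 + - ((F 1 - F 0) * (1 - q ^+ n)) * G 1 -
    (iter n transfer F 0 + - ((F 1 - F 0) * (1 - q ^+ n)) * G 0) =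
  iter n transfer F 1 - iter n transfer F 0 - (F 1 - F 0) * (1 - q ^+ n) * (G 1 - G 0) by ring.
rewrite massG mulr1 (iter_transfer_mass n lipF).
(* With [M = F 1 - F 0], the remaining mass is [M * q ^+ n], and the removed parts add up to [M * (1
   - q ^+ n) + (1 - q) * M * q ^+ n = M * (1 - q ^+ n.+1)]. *)
apply: in_cone_ext => t /andP[t0 t1].
rewrite (transfer_lin b_gt1 _ lipT lipG t0) fixG ?t0 // iterS exprS; ring.
Qed.

Lemma fixG0 : G 0 = 0.
Proof. by rewrite -fixG ?transfer0 // lexx ler01. Qed.

(** Turns a bound proportional to [x] into one proportional to [G x], which is what makes the final
    error relative. *)
Lemma id_le_G x : 0 <= x <= 1 -> x <= b ^+ 2 * G x.
Proof.
move=> /andP[x0 x1]; have := in_cone_lower coneG (lexx _) x0 x1.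
by rewrite massG mul1r !fixG0 !subr0.
Qed.

(** The remainder left by [in_cone_iter_sub] lies in the cone and has mass [(F 1 - F 0) * q ^+ n].
    Its increment on [[0, x]] is nonnegative and at most a multiple of that mass times [x], hence
    times [G x]. *)
Lemma iter_transfer_cone F n x : in_cone (N.+1 * 3) F -> 0 <= x <= 1 ->
  `|iter n transfer F x - iter n transfer F 0 - (F 1 - F 0) * G x|
    <= b ^+ (N.+1 * 3 + 2) * (F 1 - F 0) * q ^+ n * G x.
Proof.
move=> coneF x01; have /andP[x0 x1] := x01.
have lipF := in_cone_lipschitz coneF.
have coneE := in_cone_iter_sub n coneF.
have [homoE _] := coneE.
have lower := homoE 0 x (lexx _) x0 x1.
have upper := in_cone_upper coneE (lexx _) x0 x1.
have idG := id_le_G x01.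
have M0 : 0 <= F 1 - F 0 by rewrite subr_ge0; have [-> ] := coneF.
have q0 : 0 <= q ^+ n by rewrite exprn_ge0 // subr_ge0 ltW // gap_lt1.
have Mass : iter n transfer F 1 + - ((F 1 - F 0) * (1 - q ^+ n)) * G 1 -
    (iter n transfer F 0 + - ((F 1 - F 0) * (1 - q ^+ n)) * G 0) = (F 1 - F 0) * q ^+ n.
  have -> : G 1 = 1 by move: massG; rewrite fixG0 subr0.
  have := iter_transfer_mass n lipF; move: (q ^+ n) => r.
  rewrite fixG0 => <-; ring.
move: lower upper; rewrite Mass fixG0 mulr0 addr0 subr0.
have B0 : 0 <= b ^+ (N.+1 * 3) by rewrite exprn_ge0 // ltW.
have B1 : 1 <= b ^+ (N.+1 * 3 + 2) by rewrite exprn_ege1 // ltW.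
have G0 : 0 <= G x by have := coneG.1 0 x (lexx _) x0 x1; rewrite fixG0.
have Mq0 : 0 <= (F 1 - F 0) * q ^+ n by rewrite mulr_ge0.
have := ler_wpM2l (mulr_ge0 B0 Mq0) idG.
have := ler_wpM2r (mulr_ge0 Mq0 G0) B1.
rewrite exprD; move: (b ^+ (N.+1 * 3)) => B.
move: (iter n transfer F x) (iter n transfer F 0) => u v h1 h2 h3 h4.
rewrite ler_norml; apply/andP; split.
- move: h1 h3; move: (q ^+ n) (b ^+ 2) (F 1 - F 0) => *; lra.
- move: (mulr_ge0 Mq0 G0) h2 h4; move: (q ^+ n) (b ^+ 2) (F 1 - F 0) => *; lra.
Qed.

(** Integrated form of an [L]-Lipschitz density: mean slopes over two subintervals of [[x, y]]
    differ by at most [L * (y - x)], with denominators cleared. *)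
Definition unit_smooth (L : R) F : Prop :=
  forall x y a c a' c', 0 <= x -> y <= 1 ->
    x <= a -> a <= c -> c <= y -> x <= a' -> a' <= c' -> c' <= y ->
    (F c - F a) * (c' - a')
      <= (F c' - F a') * (c - a) + L * (y - x) * (c - a) * (c' - a').

Lemma in_cone_id j : in_cone j idfun.
Proof.
split=> [//|x y a c a' c' x0 y1 xa ac cy xa' ac' cy' /=].
have xy : x <= y by rewrite (le_trans xa) // (le_trans ac).
rewrite [X in _ <= X * _]mulrC ler_wpM2l //.
  by rewrite mulr_ge0 ?subr_ge0.
rewrite lerXn2r ?nnegrE ?(ltW (weight_gt0 _ _)) ?weight_homo //.
exact: le_trans xy.
Qed.

(** Since [dx / d(ln weight) = weight / (b - 1) <= b / (b - 1)], an [L]-Lipschitz density varies at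
    rate at most [L * b / (b - 1)] in the coordinate [ln weight]. Adding this constant to the
    density bounds its logarithmic derivative by 1. *)
Lemma unit_smooth_in_cone L F j : 0 <= L -> unit_homo F -> unit_smooth L F ->
  in_cone j.+1 (fun t => F t + L * b / (b - 1) * t).
Proof.
move=> L0 homoF smF; set K := L * b / (b - 1).
have K0 : 0 <= K by rewrite divr_ge0 ?mulr_ge0 // ltW.
split=> [a c a0 ac c1|x y a c a' c' x0 y1 xa ac cy xa' ac' cy'].
  by rewrite lerD ?homoF // ler_wpM2l.
have xy : x <= y by rewrite (le_trans xa) // (le_trans ac).
have y0 := le_trans x0 xy.
have {}smF := smF _ _ _ _ _ _ x0 y1 xa ac cy xa' ac' cy'.
have Fac' : 0 <= F c' - F a'.
  by rewrite subr_ge0 homoF ?(le_trans x0) // (le_trans cy').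
have wx1 := weight_ge1 b_gt1 x0; have wxy := weight_homo b_gt1 xy.
have wxb : weight x <= b by have := weight_homo b_gt1 (le_trans xy y1); rewrite weight1.
have wB : (b - 1) * (y - x) = weight y - weight x by rewrite -[weight y]/(1 + (b - 1) * y) -[weight x]/(1 + (b - 1) * x); ring.
move: (weight x) (weight y) wx1 wxy wxb wB => U V U1 UV Ub wB.
have -> : F c + K * c - (F a + K * a) = F c - F a + K * (c - a) by ring.
have -> : F c' + K * c' - (F a' + K * a') = F c' - F a' + K * (c' - a') by ring.
move: (F c - F a) (F c' - F a') smF Fac' => f f' smF f0.
have d0 : 0 <= c - a by rewrite subr_ge0.
have d0' : 0 <= c' - a' by rewrite subr_ge0.
move: (c - a) (c' - a') d0 d0' smF => d d' d0 d0' smF.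
have U0 : 0 < U by exact: lt_le_trans U1.
have V0 : 0 < V by exact: lt_le_trans UV.
have Uj0 : 0 <= U ^+ j by rewrite exprn_ge0 // ltW.
have UVj : U ^+ j <= V ^+ j by rewrite lerXn2r ?nnegrE ?(ltW U0) ?(ltW V0).
have LK : L * (y - x) * U <= K * (V - U).
  rewrite -wB (_ : K * _ = L * (y - x) * b); last by rewrite /K; field; rewrite gt_eqF.
  by rewrite ler_wpM2l // mulr_ge0 // subr_ge0.
rewrite !exprS.
apply: (@le_trans _ _ ((f' + K * d') * d * (V * U ^+ j))); last first.
  rewrite ler_wpM2l //; last by rewrite ler_wpM2l // ltW.
  by rewrite mulr_ge0 // addr_ge0 // mulr_ge0.
rewrite !mulrA ler_wpM2r //.
have s1 := ler_wpM2r (ltW U0) smF.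
have s2 := ler_wpM2l (mulr_ge0 d0 d0') LK.
have s3 : 0 <= f' * d * (V - U) by rewrite mulr_ge0 ?subr_ge0 // mulr_ge0.
move: s1 s2 s3; move: (y - x) => z; clear; lra.
Qed.

Lemma unit_lipschitz_id : unit_lipschitz 1 (idfun : R -> R).
Proof. by move=> a c a0 ac c1; rewrite mul1r ger0_norm ?subr_ge0. Qed.

(** [F] is the difference of [F + K' * id] and [K' * id], both in the cone, and the iterates are
    linear. *)
Lemma iter_transfer_smooth L K F : 0 <= L -> unit_lipschitz K F -> unit_homo F ->
  unit_smooth L F ->
  exists2 C, 0 < C & forall n x, 0 <= x <= 1 ->
    `|iter n transfer F x - iter n transfer F 0 - (F 1 - F 0) * G x|
      <= C * q ^+ n * G x.
Proof.
move=> L0 lipF homoF smF.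
set K' := L * b / (b - 1).
have K0 : 0 <= K' by rewrite divr_ge0 ?mulr_ge0 // ltW.
have cone1 : in_cone (N.+1 * 3) (fun t => F t + K' * t).
  by rewrite mulSn; exact: unit_smooth_in_cone.
have M0 : 0 <= F 1 - F 0 by rewrite subr_ge0 homoF.
have b0 : 0 <= b ^+ (N.+1 * 3 + 2) by rewrite exprn_ge0 // ltW.
(* The two cone members have masses [F 1 - F 0 + K'] and [K']; the final 1 makes the constant
   positive. *)
exists (b ^+ (N.+1 * 3 + 2) * (F 1 - F 0 + K' * 2) + 1) => [|n x x01].
  by rewrite ltr_wpDl // mulr_ge0 // addr_ge0 // mulr_ge0.
have h1 := iter_transfer_cone n cone1 x01.
have h2 := iter_transfer_cone n (in_cone_id (N.+1 * 3)) x01.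
have z01 : 0 <= (0 : R) <= 1 by rewrite lexx ler01.
move: h1; rewrite !(iter_transfer_lin _ n lipF unit_lipschitz_id) // => h1.
have /andP[x0 x1] := x01.
have qG : 0 <= q ^+ n * G x.
  apply: mulr_ge0; first by rewrite exprn_ge0 // subr_ge0 ltW // gap_lt1.
  by have := coneG.1 0 x (lexx _) x0 x1; rewrite fixG0.
have {}h2 := ler_wpM2l K0 h2.
move: h1 h2; rewrite /= !mulr1 !mulr0 addr0 subr0 mul1r mulr1.
set u := iter n _ _ _; set u' := iter n _ _ _; set v := iter n _ _ _; set v' := iter n _ _ _.
move=> h1 h2.
rewrite (_ : u - v - (F 1 - F 0) * G x = (u + K' * u' - (v + K' * v') - (F 1 + K' - F 0) * G x)
   - K' * (u' - v' - G x)); last by ring.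
apply: (le_trans (ler_normB _ _)).
rewrite (normrM K') (ger0_norm K0).
apply: (le_trans (lerD h1 h2)); move: qG.
move: (b ^+ _) (q ^+ n) (G x) => *; lra.
Qed.

End Gauss.
End Iteration.

(** * The explicit invariant distribution *)

Section GaussFixpoint.
Context {R : realType} (b : R) (b_gt1 : 1 < b).
Implicit Types (x y a c : R).
Local Notation weight := (weight b).
Local Notation branch := (branch b).

Let b_gt0 : 0 < b. Proof. exact: lt_trans b_gt1. Qed.

Let b1_gt0 : 0 < b - 1. Proof. by rewrite subr_gt0. Qed.

Definition gauss_distr x : R :=
  ln (b * ((b - 1) * x + 1) / ((b - 1) * x + b)) / ln (b ^+ 2 / (2 * b - 1)).

Let phi x : R := ln (weight x) - ln (weight x + (b - 1)).

Lemma ln_gauss_gt0 : 0 < ln (b ^+ 2 / (2 * b - 1)).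
Proof.
have b1 := b_gt1; have sq := mulr_gt0 b1_gt0 b1_gt0.
have b2 : 0 < 2 * b - 1 by lra.
by rewrite ln_gt0 // ltr_pdivlMr // mul1r expr2; lra.
Qed.

Let gaussE x : 0 <= x -> gauss_distr x = (ln b + phi x) / ln (b ^+ 2 / (2 * b - 1)).
Proof.
move=> x0; rewrite /gauss_distr /phi; have w0 := weight_gt0 b_gt1 x0.
have -> : (b - 1) * x + 1 = weight x by rewrite addrC.
have -> : (b - 1) * x + b = weight x + (b - 1).
  by rewrite -[weight x]/(1 + (b - 1) * x); ring.
have w1 : 0 < weight x + (b - 1) by rewrite addr_gt0.
by rewrite ln_div ?posrE ?mulr_gt0 // lnM ?posrE // -addrA.
Qed.

Lemma gauss_distr0 : gauss_distr 0 = 0.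
Proof. by rewrite /gauss_distr mulr0 !add0r mulr1 divff ?gt_eqF // ln1 mul0r. Qed.

Lemma gauss_distr1 : gauss_distr 1 = 1.
Proof.
have -> : gauss_distr 1 = ln (b ^+ 2 / (2 * b - 1)) / ln (b ^+ 2 / (2 * b - 1)).
  by congr (ln _ / _); rewrite mulr1 subrK expr2; congr (_ / _); ring.
by rewrite divff // gt_eqF // ln_gauss_gt0.
Qed.

(** Derivative of [phi], hence the invariant density up to its normalising constant. *)
Let dphi x : R := (b - 1) ^+ 2 / (weight x * (weight x + (b - 1))).

Let is_derive_phi x : 0 <= x -> is_derive x 1 phi (dphi x).
Proof.
move=> x0; have w0 := weight_gt0 b_gt1 x0.
have w1 : 0 < weight x + (b - 1) by rewrite addr_gt0.
have dw e : is_derive x 1 (fun t => weight t + e) (b - 1).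
  rewrite (_ : (fun t => _) = (cst (1 + e) + (b - 1) *: id)); last first.
    apply/funext => t; change (1 + (b - 1) * t + e = 1 + e + (b - 1) * t); ring.
  apply: (is_derive_eq (is_deriveD (is_derive_cst (1 + e) x 1)
    (is_deriveZ (b - 1) (is_derive_id x 1)))).
  by rewrite add0r; exact: mulr1.
have dw0 : is_derive x 1 weight (b - 1).
  have := dw 0; rewrite (_ : (fun t => weight t + 0) = weight) //.
  by apply/funext => t; rewrite addr0.
have d1 : is_derive x 1 (@ln R \o weight) ((weight x)^-1 * (b - 1)).
  have dl := is_derive1_ln w0.
  exact: is_derive1_comp.
have d2 : is_derive x 1 (@ln R \o (fun t => weight t + (b - 1)))
    ((weight x + (b - 1))^-1 * (b - 1)).
  have dl := is_derive1_ln w1; have dw' := dw (b - 1).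
  exact: is_derive1_comp.
have := is_deriveB d1 d2.
congr (is_derive _ _ _ _).
by rewrite /dphi; field; rewrite !gt_eqF.
Qed.

Let phi_mvt a c : 0 <= a -> a <= c ->
  exists2 z, a <= z <= c & phi c - phi a = dphi z * (c - a).
Proof.
move=> a0 ac.
have [||z] := @MVT_segment _ phi dphi a c ac.
- by move=> x; rewrite in_itv /= => /andP[/ltW ax _]; apply: is_derive_phi (le_trans a0 ax).
- apply: continuous_in_subspaceT => x; rewrite inE /= in_itv /= => /andP[ax _].
  have [dx _] := is_derive_phi (le_trans a0 ax).
  exact/differentiable_continuous/derivable1_diffP.
- by rewrite in_itv /= => zac; exists z.
Qed.

(** The density is proportional to [1 / (w (w + b - 1))] with [w = weight x]; its logarithmic
    derivative in [ln w] is [-1 - w / (w + b - 1)], between -2 and -1. Mean value points stand in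
    for the slopes. *)
Lemma gauss_distr_cone : in_cone b 2 gauss_distr.
Proof.
have diff a c : 0 <= a -> a <= c -> exists2 z, a <= z <= c &
    gauss_distr c - gauss_distr a = (c - a) * dphi z / ln (b ^+ 2 / (2 * b - 1)).
  move=> a0 ac; have [z zac E] := phi_mvt a0 ac; exists z => //.
  rewrite !gaussE ?(le_trans a0) // -mulrBl; congr (_ / _).
  by rewrite mulrC -E; ring.
have dphi_gt0 z : 0 <= z -> 0 < dphi z.
  move=> z0; have w0 := weight_gt0 b_gt1 z0.
  by rewrite divr_gt0 ?exprn_gt0 // mulr_gt0 // addr_gt0.
split=> [a c a0 ac _|x y a c a' c' x0 y1 xa ac cy xa' ac' cy'].
  rewrite -subr_ge0; have [z /andP[az _] ->] := diff a c a0 ac.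
  rewrite mulr_ge0 ?invr_ge0 ?(ltW ln_gauss_gt0) // mulr_ge0 ?subr_ge0 //.
  exact/ltW/dphi_gt0/(le_trans a0).
have a0 := le_trans x0 xa; have a0' := le_trans x0 xa'.
have [z /andP[az zc] ->] := diff a c a0 ac.
have [z' /andP[az' zc'] ->] := diff a' c' a0' ac'.
have Di : 0 < (ln (b ^+ 2 / (2 * b - 1)))^-1 by rewrite invr_gt0 ln_gauss_gt0.
set D := _^-1 in Di *.
have -> : (c - a) * dphi z * D * (c' - a') * weight x ^+ 2 =
    (c - a) * (c' - a') * D * (dphi z * weight x ^+ 2) by ring.
have -> : (c' - a') * dphi z' * D * (c - a) * weight y ^+ 2 =
    (c - a) * (c' - a') * D * (dphi z' * weight y ^+ 2) by ring.
apply: ler_wpM2l.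
  by rewrite mulr_ge0 ?(ltW Di) // mulr_ge0 ?subr_ge0.
have xz := weight_homo b_gt1 (le_trans xa az).
have zy := weight_homo b_gt1 (le_trans zc' cy').
have xy := weight_homo b_gt1 (le_trans xa (le_trans ac cy)).
rewrite /dphi.
have wx := weight_gt0 b_gt1 x0; have wz := lt_le_trans wx xz.
have wz' := weight_gt0 b_gt1 (le_trans a0' az').
move: (weight x) (weight y) (weight z) (weight z') xz zy xy wx wz wz' => X Y Z Z' xz zy xy X0 Z0 Z0'.
have B0 : 0 < b - 1 by [].
move: (b - 1) B0 => B B0.
have P0 : 0 < Z * (Z + B) by rewrite mulr_gt0 // addr_gt0.
have P0' : 0 < Z' * (Z' + B) by rewrite mulr_gt0 // addr_gt0.
rewrite mulrAC [X in _ <= X]mulrAC ler_pdivrMr //.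
rewrite [X in _ <= X]mulrAC ler_pdivlMr //.
rewrite -!(mulrA (B ^+ 2)) ler_pM2l ?exprn_gt0 //.
have h1 : X ^+ 2 <= Z * (Z + B) by rewrite expr2 ler_pM //; lra.
have h2 : Z' * (Z' + B) * X ^+ 2 <= Y * (Y + B) * X ^+ 2.
  by rewrite ler_wpM2r ?sqr_ge0 // ler_pM //; lra.
have h3 : X ^+ 2 * (Y * (Y + B)) <= (Z * (Z + B)) * Y ^+ 2.
  rewrite !expr2.
  have YX : 0 < Y by lra.
  have : X * (X * (Y + B)) <= Z * ((Z + B) * Y).
    rewrite ler_pM //; first lra.
    + by rewrite mulr_ge0 //; lra.
    + have Xy : X * B <= B * Y by rewrite mulrC ler_wpM2l //; lra.
      have : X * Y <= Z * Y by rewrite ler_wpM2r //; lra.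
      lra.
  by move=> /(ler_wpM2r (ltW YX)); lra.
lra.
Qed.

Let kappa (i : nat) : R := (b - 1) * b ^- i.

(** Written with [kappa i = b * kappa i.+1], the composite with a branch is, up to a constant, a
    difference of consecutive terms in [i]. *)
Let phi_branch i x : 0 <= x ->
  phi (branch i x) = ln (weight x + kappa i) - ln b - ln (weight x + kappa i.+1).
Proof.
move=> x0; have w0 := weight_gt0 b_gt1 x0.
have k0 j : 0 < kappa j by rewrite mulr_gt0 // expVn_gt0.
have wE : weight (branch i x) = (weight x + kappa i) / weight x.
  have -> : weight (branch i x) = 1 + kappa i / weight x by rewrite /kappa -mulrA.
  by field; rewrite gt_eqF.
have wE' : weight (branch i x) + (b - 1) = b * (weight x + kappa i.+1) / weight x.
  rewrite wE; have -> : kappa i = b * kappa i.+1.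
    by rewrite /kappa exprS invfM; field; rewrite expf_neq0 ?gt_eqF.
  by field; rewrite gt_eqF.
have wk j : 0 < weight x + kappa j by rewrite addr_gt0.
have bwk := mulr_gt0 b_gt0 (wk i.+1).
rewrite /phi wE' wE !ln_div ?posrE // lnM ?posrE //.
by ring.
Qed.

(** By [phi_branch] the series telescopes. As [kappa n] tends to 0 and [kappa 0 = b - 1], its limit
    is again the distribution itself. *)
Lemma transfer_gauss x : 0 <= x <= 1 -> transfer b gauss_distr x = gauss_distr x.
Proof.
move=> /andP[x0 x1]; have w0 := weight_gt0 b_gt1 x0.
set D := ln (b ^+ 2 / (2 * b - 1)).
have cvg_ln w : 0 < w -> ln (w + kappa n) @[n --> \oo] --> ln w.
  move=> wp; have : (w + kappa n) @[n --> \oo] --> w.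
    rewrite -[X in _ --> X]addr0; apply: cvgD; first exact: cvg_cst.
    by rewrite -(mulr0 (b - 1)); apply: cvgMl_tmp; exact: cvg_expVn.
  by apply: continuous_cvg; exact: continuous_ln.
apply: cvg_lim => //.
have -> : series (fun i => gauss_distr (branch i 0) - gauss_distr (branch i x)) =
  (fun n => (ln (1 + kappa 0) - ln (1 + kappa n) -
    (ln (weight x + kappa 0) - ln (weight x + kappa n))) / D).
  apply/funext => n; elim: n => [|n IH].
    by rewrite /series /= big_geq // !subrr mul0r.
  rewrite seriesSr IH !gaussE ?branch_ge0 // -/D !phi_branch // weight0.
  ring.
rewrite gaussE //; apply: cvgMr_tmp.
have -> : ln b + phi x = ln (1 + kappa 0) - ln 1 - (ln (weight x + kappa 0) - ln (weight x)).
  have -> : kappa 0 = b - 1 by rewrite /kappa expr0 invr1 mulr1.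
  have -> : 1 + (b - 1) = b by rewrite addrC subrK.
  by rewrite /phi ln1; ring.
by apply: cvgB; apply: cvgB; try exact: cvg_cst; exact: cvg_ln.
Qed.

End GaussFixpoint.

(** * Slopes of the distribution function from its almost everywhere derivative *)

Section Density.
Context {R : realType} (mu : probability (measurableTypeR R) R).
Hypothesis mu_ac : mu `<< @lebesgue_measure R.
Local Notation leb := (@lebesgue_measure R).

Lemma ac_density : exists2 g : R -> R, leb.-integrable setT (EFin \o g) &
  forall A, measurable A -> mu A = (\int[leb]_(x in A) (g x)%:E)%E.
Proof.
pose nu := charge_of_finite_measure mu.
have nu_ac : nu `<< leb by exact: mu_ac.
have fin x : (Radon_Nikodym nu leb x) \is a fin_num by exact: Radon_Nikodym_fin_num.
exists (fine \o Radon_Nikodym nu leb).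
  rewrite (_ : EFin \o _ = Radon_Nikodym nu leb); first exact: Radon_Nikodym_integrable.
  by apply/funext => x /=; rewrite fineK.
move=> A mA; have -> : mu A = _ := Radon_Nikodym_integral nu_ac mA.
by apply: eq_integral => x _; rewrite /= fineK.
Qed.

Lemma distr_funB a c : 0 <= a -> a <= c ->
  mu `]a, c]%classic = (distr_fun mu c - distr_fun mu a)%:E.
Proof.
move=> a0 ac.
have U : `[0, c]%classic = `[0, a]%classic `|` `]a, c]%classic.
  by rewrite (@itv_bndbnd_setU _ _ _ (BRight a)) ?bnd_simp.
have fin (A : set R) : measurable A -> mu A \is a fin_num.
  by move=> mA; exact: fin_num_measure.
rewrite /distr_fun U measureU //; last first.
  apply/seteqP; split=> // x /= []; rewrite !in_itv /= => /andP[_ xa] /andP[ax _].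
  by have := lt_le_trans ax xa; rewrite ltxx.
by rewrite fineD ?fin // [X in X - _]addrC addrK fineK ?fin.
Qed.

(** The increment is the integral of the Radon-Nikodym density, which agrees almost everywhere with
    [f]. All later use of [f] as a derivative passes through these bounds. *)
Lemma distr_fun_slope f a c l u : distr_deriv mu f -> 0 <= a -> a <= c -> c <= 1 ->
  (forall x, a <= x <= c -> l <= f x <= u) ->
  l * (c - a) <= distr_fun mu c - distr_fun mu a <= u * (c - a).
Proof.
move=> f_deriv a0 ac c1 lfu.
have [g intg muE] := ac_density.
have intgS (A : set (measurableTypeR R)) : measurable A -> leb.-integrable A (EFin \o g).
  by move=> mA; exact: integrableS intg.
have FE : distr_fun mu = (fun x => \int[leb]_(t in `[0, x]) g t)%R.
  by apply/funext => x; rewrite /distr_fun muE.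
have loc : locally_integrable setT g by apply: open_integrable_locally => //; exact: openT.
have ftc := @FTC1 R g (BLeft 0) (fun y => intgS _ (measurable_itv _)) loc.
(* By Lebesgue differentiation the integral of [g] has derivative [g] almost everywhere, and [f] is
   almost everywhere a derivative of the same function. *)
have [N [mN N0 Nsub]] : {ae leb, forall x : R, x \in `]0, 1[ -> f x = g x}.
  move: f_deriv ftc; apply: (@filterS2 _ _ (ae_filter_ringOfSetsType leb)) => x fx gx x01.
  have dF := fx x01.
  have x0 : (0 : R) < x by move: x01; rewrite in_itv => /andP[].
  have [|_ <-] := gx; first by rewrite lte_fin.
  by rewrite -FE derive1E (@derive_val _ _ _ _ _ _ _ dF).
(* The identity [f = g] is known only inside []0, 1[]; the interval []a, c]] omits 0 but may contain
   1. *)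
pose E : set (measurableTypeR R) := N `|` [set 1].
have m1 : measurable E by exact: measurableU.
have N1 : leb E = 0%E.
  by rewrite measureU0 //; exact: lebesgue_measure_set1.
have mD : measurable (`]a, c]%classic : set (measurableTypeR R)) by exact: measurable_itv.
have mDN : measurable (`]a, c] `\` E : set (measurableTypeR R)) by exact: measurableD.
have lebac : leb `]a, c]%classic = (c - a)%:E.
  rewrite lebesgue_measure_itv /= lte_fin; case: ifPn => [_|]; first by rewrite EFinB.
  by rewrite -leNgt => ca; rewrite (@le_anti _ _ a c) ?ac // subrr.
have lebac_fin : (leb `]a, c]%classic < +oo)%E by rewrite lebac ltry.
have lebD : leb (`]a, c] `\` E) = (c - a)%:E.
  rewrite -lebac measureD //.
  rewrite [X in (_ - X)%E](_ : _ = 0%E) ?sube0 //.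
  by apply: (@subset_measure0 _ _ _ leb _ E) => //; exact: measurableI.
have cE (r : R) :
    (\int[leb]_(x in `]a, c] `\` E) (EFin \o cst r) x = (r * (c - a))%:E)%E.
  rewrite EFinM; apply: (etrans (@integral_cst _ _ _ leb _ mDN r%:E)).
  by congr (_ * _)%E; exact: lebD.
have intc (r : R) : leb.-integrable (`]a, c] `\` E) (EFin \o cst r).
  apply/integrableP; split; first by apply/measurable_EFinP; exact: measurable_cst.
  by have := cE `|r| => /= ->; rewrite ltry.
have good x : (`]a, c] `\` E) x -> l <= g x <= u.
  move=> [/= ]; rewrite in_itv /= => /andP[ax xc] /not_orP[Nx x1].
  have <- : f x = g x.
    apply: contrapT => fg; apply: Nx; apply: Nsub => /= H; apply: fg; apply: H.
    rewrite in_itv /= (le_lt_trans a0 ax) /= lt_neqAle (le_trans xc c1) andbT.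
    exact/eqP.
  by apply: lfu; rewrite (ltW ax).
rewrite -!lee_fin -(distr_funB a0 ac) muE //.
rewrite (negligible_integral m1 mD (intgS _ mD) N1).
rewrite -!cE; apply/andP; split; apply: le_integral => // [|x].
- exact: intgS.
- by rewrite inE => Dx; have /andP[gl _] := good x Dx; rewrite lee_fin.
- exact: intgS.
- by rewrite inE => Dx; have /andP[_ gu] := good x Dx; rewrite lee_fin.
Qed.

End Density.

(** * The shift map: cells, inverse branches, measurability *)

Section Events.
Context {R : realType} (m : nat) (m_ge2 : (2 <= m)%N).
Local Notation b := (m%:R : R).
Local Notation T := (@cf_shift R m).
Local Notation branch := (branch b).
Local Notation weight := (weight b).

Lemma base_gt1 : 1 < b. Proof. by rewrite ltr1n. Qed.

Let b_gt0 : 0 < b. Proof. exact: lt_trans base_gt1. Qed.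

Let b1_gt0 : 0 < b - 1. Proof. by rewrite subr_gt0 base_gt1. Qed.

Let lnb_gt0 : 0 < ln b. Proof. by rewrite ln_gt0 // base_gt1. Qed.

Lemma cf_shift0 : T 0 = 0. Proof. by rewrite /cf_shift eqxx. Qed.

(** Exponentiating the bounds that define the floor locates [t] in the cell of its digit [i], and
    [b] to the power [cf_log m t - i] is [b ^- i / t]. *)
Lemma cf_shiftE t : 0 < t -> t <= 1 ->
  exists2 i, b ^- i.+1 < t <= b ^- i & T t = (b ^- i / t - 1) / (b - 1).
Proof.
move=> t0 t1; have s0 : 0 <= cf_log m t.
  by rewrite /cf_log divr_ge0 ?(ltW lnb_gt0) // ln_ge0 // invf_ge1.
have sE : cf_log m t * ln b = - ln t.
  by rewrite /cf_log divfK ?gt_eqF // lnV // posrE.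
have expE i : b ^- i = expR (- (i%:R * ln b)).
  by rewrite expRN expRM_natl lnK // posrE.
have tE : t = expR (- (cf_log m t * ln b)) by rewrite sE opprK lnK ?posrE.
have := floor_ge0 (cf_log m t); rewrite s0.
have := floor_itv (cf_log m t); rewrite -/(cf_digit m t).
case E : (cf_digit m t) => [i|i] /andP[lo hi] i0; last by [].
have lo' : i%:R <= cf_log m t by [].
have hi' : cf_log m t < i.+1%:R by rewrite -natr1; move: hi; rewrite intrD.
exists i.
  rewrite {1 2}tE !expE ltr_expR ler_expR ltrN2 lerN2.
  by rewrite ltr_pM2r // ler_pM2r // hi' lo'.
rewrite /cf_shift gt_eqF // E; congr ((_ - _) / _).
rewrite /powR gt_eqF // mulrBl sE expRD !expRN -[i%:~R]/(i%:R : R) expRM_natl.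
by rewrite !lnK ?posrE // mulrC.
Qed.

Lemma cf_shift_itv t : 0 <= t <= 1 -> 0 <= T t <= 1.
Proof.
move=> /andP[]; rewrite le_eqVlt => /orP[/eqP <- _|t0 t1].
  by rewrite cf_shift0 lexx ler01.
have [i /andP[lo hi] ->] := cf_shiftE t0 t1.
rewrite divr_ge0 ?(ltW b1_gt0) //; last by rewrite subr_ge0 ler_pdivlMr ?mul1r.
have -> : b ^- i = b * b ^- i.+1 by rewrite exprS invfM mulrA divff ?gt_eqF // mul1r.
by rewrite ler_pdivrMr // mul1r lerD2r ler_pdivrMr // ler_pM2l // ltW.
Qed.

(** On the cell of digit [i] the map decreases with inverse [branch i]. Conversely []branch j x, b
    ^- j]] lies in the cell of digit [j], so [t] determines [j]. The point 0 is fixed by the map and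
    listed apart. *)
Lemma cf_shift_lt t x : 0 <= t <= 1 -> 0 < x <= 1 ->
  T t < x <-> t = 0 \/ exists i, branch i x < t <= b ^- i.
Proof.
move=> /andP[t0 t1] /andP[x0 x1]; have w0 := weight_gt0 base_gt1 (ltW x0).
move: t0; rewrite le_eqVlt => /orP[/eqP <-|t0].
  by rewrite cf_shift0; split=> // _; left.
have [i /andP[lo hi] ->] := cf_shiftE t0 t1.
have shift_lt : ((b ^- i / t - 1) / (b - 1) < x) = (branch i x < t).
  rewrite ltr_pdivrMr // ltrBlDr ltr_pdivrMr // /branch ltr_pdivrMr //.
  by rewrite [_ + 1]addrC [x * _]mulrC [t * _]mulrC.
rewrite shift_lt; split=> [bt|[t_eq0|[j /andP[bj tj]]]].
- by right; exists i; rewrite bt.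
- by rewrite t_eq0 ltxx in t0.
- have [ij|ji|->//] := ltngtP i j.
  + have : b ^- j <= b ^- i.+1 by rewrite lef_pV2 ?posrE ?exprn_gt0 // ler_weXn2l // ltW // base_gt1.
    by move=> /(le_trans tj) /le_lt_trans/(_ lo); rewrite ltxx.
  + have : b ^- i <= b ^- j.+1 by rewrite lef_pV2 ?posrE ?exprn_gt0 // ler_weXn2l // ltW // base_gt1.
    rewrite -branch1 => /le_trans/(_ (branch_anti base_gt1 j (ltW x0) x1)).
    by move=> /(le_trans hi)/le_lt_trans/(_ bj); rewrite ltxx.
Qed.

Lemma cf_shift_eq t c : 0 <= t <= 1 -> T t = c ->
  t = 0 \/ exists i, t = branch i c.
Proof.
move=> /andP[]; rewrite le_eqVlt => /orP[/eqP <-|t0 t1]; first by left.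
have [i _ ->] := cf_shiftE t0 t1 => <-; right; exists i.
have := expVn_gt0 base_gt1 i; rewrite /branch; move: (b ^- i) => B B0.
have -> : weight ((B / t - 1) / (b - 1)) = B / t.
  rewrite -[LHS]/(1 + (b - 1) * ((B / t - 1) / (b - 1))).
  by rewrite mulrCA divff ?gt_eqF // mulr1 addrC subrK.
by field; rewrite !gt_eqF.
Qed.

Lemma measurable_cf_shift : measurable_fun setT (T : R -> R).
Proof.
have mlog : measurable_fun setT (@cf_log R m : R -> R).
  (* The identity [ln x^-1 = - ln x] also holds for [x <= 0], where both logarithms take the default
     value 0. *)
  rewrite (_ : cf_log m = (fun x => - ln x * (ln b)^-1)); last first.
    apply/funext => x; rewrite /cf_log; congr (_ / _).
    have [x0|x0] := ltP 0 x; first by rewrite lnV // posrE.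
    by rewrite !ln0 ?oppr0 // invr_le0.
  apply: measurable_funM => //; apply: measurable_funN.
  exact: measurable_ln.
have mfloor : measurable_fun setT
    (fun x : R => (Num.floor x)%:~R : R).
  by apply: nondecreasing_measurable => // x y xy; rewrite ler_int le_floor.
apply: measurable_fun_ifT => //; first exact: measurable_fun_eqr.
apply: measurable_funM => //; apply: measurable_funB => //.
apply: (measurableT_comp (measurable_powRr b)).
apply: measurable_funB => //.
exact: (measurableT_comp mfloor mlog).
Qed.

Lemma iter_cf_shift_itv n t : 0 <= t <= 1 -> 0 <= iter n T t <= 1.
Proof. by move=> t01; elim: n => //= n; exact: cf_shift_itv. Qed.

Lemma measurable_iter_cf_shift n :
  measurable_fun setT (iter n T : R -> R).
Proof.
elim: n => [|n IH]; first exact: measurable_id.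
exact: measurableT_comp measurable_cf_shift IH.
Qed.

(** * Distribution of the iterates under [mu] *)

Section Distribution.
Variable mu : probability (measurableTypeR R) R.
Hypothesis mu_ac : mu `<< @lebesgue_measure R.
Local Notation orbit_in n A :=
  (`[0, 1] `&` iter n T @^-1` A : set (measurableTypeR R)).

Lemma measurable_orbit_in n (A : set (measurableTypeR R)) :
  measurable A -> measurable (orbit_in n A).
Proof.
move=> mA.
have mI : measurable (`[0, 1]%classic : set (measurableTypeR R)) by exact: measurable_itv.
exact: (measurable_funTS (@measurable_iter_cf_shift n) mI mA).
Qed.

(** Points are null by absolute continuity, and [cf_shift_eq] makes each preimage of a point
    countable. Strict and weak inequalities thus define events of equal measure. *)
Lemma orbit_eq_negligible n c : mu.-negligible (orbit_in n [set c]).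
Proof.
elim: n c => [|n IH] c.
  apply: (@negligibleS _ _ _ mu [set c]) => [t []//|].
  exists [set c]; split => //.
  apply: ((null_content_dominatesP _ _).1 mu_ac) => //.
  exact: lebesgue_measure_set1.
apply: (@negligibleS _ _ _ mu (orbit_in n [set 0] `|`
    \bigcup_i orbit_in n [set branch i c])).
  move=> t [t01 /= Tt].
  have [T0|[i Ti]] := cf_shift_eq (iter_cf_shift_itv n t01) Tt; first by left.
  by right; exists i.
by apply: negligibleU => //; exact: negligible_bigcup.
Qed.

Definition cf_distr n x : R := fine (mu (cf_event m n x)).

Lemma cf_event_orbit n x : cf_event m n x = orbit_in n `]-oo, x[%classic.
Proof. by apply/seteqP; split=> t [t01 /= tx]; split; move: tx; rewrite /= in_itv. Qed.

Lemma measurable_cf_event n x : measurable (cf_event m n x : set (measurableTypeR R)).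
Proof. rewrite cf_event_orbit; apply: measurable_orbit_in; exact: measurable_itv. Qed.

Lemma mu_cf_event n x : mu (cf_event m n x) = (cf_distr n x)%:E.
Proof. by rewrite fineK // fin_num_measure //; exact: measurable_cf_event. Qed.

Lemma mu_orbit_le n x : mu (orbit_in n `]-oo, x]%classic) = (cf_distr n x)%:E.
Proof.
rewrite -mu_cf_event cf_event_orbit.
have -> : orbit_in n `]-oo, x]%classic = orbit_in n `]-oo, x[%classic `|` orbit_in n [set x].
  rewrite -setIUr -preimage_setU; congr (_ `&` _ @^-1` _).
  by rewrite setUitv1.
rewrite measureU0 //; try exact: measurable_orbit_in (measurable_itv _).
  exact: measurable_orbit_in (measurable_set1 _).
by apply/negligibleP; [exact: measurable_orbit_in (measurable_set1 _)|exact: orbit_eq_negligible].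
Qed.

Lemma mu_orbit_itv n a c : a <= c ->
  mu (orbit_in n `]a, c]%classic) = (cf_distr n c - cf_distr n a)%:E.
Proof.
move=> ac.
have : (mu (orbit_in n `]-oo, c]%classic) =
    mu (orbit_in n `]-oo, a]%classic) + mu (orbit_in n `]a, c]%classic))%E.
  rewrite -[RHS]measureU; try exact: measurable_orbit_in (measurable_itv _).
    rewrite -setIUr -preimage_setU; congr (mu (_ `&` _ @^-1` _)).
    by rewrite (@itv_bndbnd_setU _ _ _ (BRight a)) ?bnd_simp.
  apply/seteqP; split=> // t [[_ /=]]; rewrite in_itv /= => ta [_ /=].
  by rewrite in_itv /= => /andP[/(le_lt_trans ta)]; rewrite ltxx.
by rewrite !mu_orbit_le EFinB => ->; rewrite addeAC subee ?add0e.
Qed.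

(** Up to the null event that the [n]-th iterate is 0, the event is the disjoint union over the
    digit [i] of the next step. Countable additivity yields the series defining [transfer]. *)
Lemma cf_distrS n x : 0 <= x <= 1 ->
  cf_distr n.+1 x = transfer b (cf_distr n) x.
Proof.
move=> /andP[]; rewrite le_eqVlt => /orP[/eqP <- _|x0 x1].
  rewrite transfer0 /cf_distr (_ : cf_event m n.+1 0 = set0) ?measure0 //.
  apply/seteqP; split=> // t [t01 /=]; rewrite ltNge.
  by have /andP[-> _] := iter_cf_shift_itv n.+1 t01.
pose A i := orbit_in n `]branch i x, b ^- i]%classic.
have mA i : measurable (A i) by exact: measurable_orbit_in (measurable_itv _).
have muA i : mu (A i) = (cf_distr n (branch i 0) - cf_distr n (branch i x))%:E.
  rewrite branch0 -mu_orbit_itv // -branch0; apply: branch_anti => //.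
    exact: base_gt1.
  exact: ltW.
have eventE : cf_event m n.+1 x = \bigcup_i A i `|` orbit_in n [set 0].
  apply/seteqP; split=> [t [t01 /= Tx]|t].
    have /cf_shift_lt := iter_cf_shift_itv n t01; move=> /(_ x) [|/(_ Tx) + _].
      by rewrite x0.
    by case=> [T0|[i Ti]]; [right|left; exists i => //; split; rewrite //= in_itv].
  move=> [[i _ [t01 /=]]|[t01 /= T0]].
    rewrite in_itv /= => Ti; split=> //=.
    by apply/cf_shift_lt; rewrite ?iter_cf_shift_itv ?x0 //; right; exists i.
  by split=> //=; rewrite T0 cf_shift0.
have mU : measurable (\bigcup_i A i) by exact: bigcup_measurable.
have eventU : mu (cf_event m n.+1 x) = mu (\bigcup_i A i).
  rewrite eventE measureU0 //; first exact: measurable_orbit_in (measurable_set1 _).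
  by apply/negligibleP; [exact: measurable_orbit_in (measurable_set1 _)|exact: orbit_eq_negligible].
have disj : trivIset setT A.
  apply/trivIsetP.
  have lt_disj i j : (i < j)%N -> A i `&` A j = set0.
    move=> ij; apply/seteqP; split=> // t [[_ /=]]; rewrite in_itv /= => /andP[lo _].
    move=> [_ /=]; rewrite in_itv /= => /andP[_ hi].
    have : b ^- j <= b ^- i.+1 by rewrite lef_pV2 ?posrE ?exprn_gt0 // ler_weXn2l // ltW // base_gt1.
    rewrite -branch1 => /(le_trans hi).
    move=> /le_trans/(_ (branch_anti base_gt1 i (ltW x0) x1))/le_lt_trans/(_ lo).
    by rewrite ltxx.
  move=> i j _ _; rewrite neq_ltn => /orP[/lt_disj//|/lt_disj].
  by rewrite setIC.
have : (\sum_(0 <= i < k) mu (A i))%E @[k --> \oo] --> (cf_distr n.+1 x)%:E.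
  by rewrite -mu_cf_event eventU; exact: measure_semi_sigma_additive.
rewrite (_ : (fun k => _) = EFin \o
    series (fun i => cf_distr n (branch i 0) - cf_distr n (branch i x))); last first.
  by apply/funext => k; rewrite /series /= -sumEFin; apply: eq_bigr => i _; exact: muA.
by move=> /fine_cvg cvgA; apply/esym/cvg_lim.
Qed.

Lemma cf_distr_iter n x : 0 <= x <= 1 ->
  cf_distr n x = iter n (transfer b) (cf_distr 0) x.
Proof.
elim: n x => [//|n IH] x x01; rewrite cf_distrS //.
by apply: transfer_ext => //; [exact: base_gt1|have /andP[] := x01].
Qed.

Lemma cf_distr0 x : 0 <= x <= 1 -> cf_distr 0 x = distr_fun mu x.
Proof.
move=> /andP[x0 x1]; rewrite /distr_fun.
have -> : `[0, x]%classic = orbit_in 0 `]-oo, x]%classic.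
  apply/seteqP; split=> t /=; rewrite !in_itv /=; last by move=> [/andP[-> _] ->].
  by move=> /andP[-> tx]; split=> //; exact: le_trans x1.
by rewrite mu_orbit_le.
Qed.

End Distribution.
End Events.

(** * Distributions whose iterates converge to the invariant law *)

Section Equidistribution.
Context {R : realType} (b : R) (b_gt1 : 1 < b) (N : nat) (bN : b <= N.+1%:R).
Implicit Types (F H : R -> R) (x y a c : R).
Local Notation transfer := (transfer b).
Local Notation G := (gauss_distr b).

Let b_gt0 : 0 < b. Proof. exact: lt_trans b_gt1. Qed.

Lemma iter_transferS0 F n : iter n.+1 transfer F 0 = 0.
Proof. exact: transfer0. Qed.

Definition equidistributed F : Prop :=
  (exists K, unit_lipschitz K F) /\
  forall x, 0 <= x <= 1 ->
    iter n transfer F x @[n --> \oo] --> (F 1 - F 0) * G x.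

Lemma gauss_distr_itv x : 0 <= x <= 1 -> 0 <= G x <= 1.
Proof.
move=> /andP[x0 x1]; have [homoG _] := gauss_distr_cone b_gt1.
have := homoG 0 x (lexx _) x0 x1; have := homoG x 1 x0 x1 (lexx _).
by rewrite gauss_distr0 // gauss_distr1 // => -> ->.
Qed.

Lemma gauss_mass : G 1 - G 0 = 1.
Proof. by rewrite gauss_distr0 ?gauss_distr1 // subr0. Qed.

Lemma equidistributed_smooth K L F : 0 <= L -> unit_lipschitz K F ->
  unit_homo F -> unit_smooth L F -> equidistributed F.
Proof.
move=> L0 lipF homoF smF; split; first by exists K.
have [C C0 bound] := iter_transfer_smooth b_gt1 bN (gauss_distr_cone b_gt1) gauss_mass
  (transfer_gauss b_gt1) L0 lipF homoF smF.
(* From the first iterate on, the value at 0 is 0; the shift of index removes that term from the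
   bound. *)
move=> x x01; rewrite -cvg_shiftS.
set q := 1 - _ in bound.
have q1 : `|q| < 1.
  have g0 := gap_gt0 b_gt1 (N * 3 + 2); have g1 := gap_lt1 b_gt1 (N * 3 + 2).
  by rewrite ger0_norm /q; lra.
have cvgq : (C * q ^+ n.+1 * G x) @[n --> \oo] --> 0.
  rewrite -(mul0r (G x)); apply: cvgMr_tmp; rewrite -(mulr0 C).
  by apply: cvgMl_tmp; rewrite (cvg_shiftS (fun n => q ^+ n)); exact: cvg_expr.
apply/cvgrPdist_le => e e0; near=> n.
have := bound n.+1 x x01; rewrite iter_transferS0 subr0 distrC => /le_trans; apply.
rewrite (le_trans (ler_norm _)) // -normrN -[- _]add0r.
by near: n; exact: cvgr_dist_le.
Unshelve. all: by end_near. Qed.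

Lemma equidistributed_lin F H (e : R) : equidistributed F -> equidistributed H ->
  equidistributed (fun t => F t + e * H t).
Proof.
move=> [[K lipF] cvgF] [[K' lipH] cvgH]; split.
  by exists (K + `|e| * K'); exact: unit_lipschitz_lin.
move=> x x01.
rewrite (_ : _ * G x = (F 1 - F 0) * G x + e * ((H 1 - H 0) * G x)); last by ring.
rewrite (_ : (fun n => _) = (fun n => iter n transfer F x + e * iter n transfer H x)).
  by apply: cvgD; [exact: cvgF|apply: cvgMl_tmp; exact: cvgH].
by apply/funext => n; exact: (iter_transfer_lin b_gt1 _ _ lipF lipH).
Qed.

Lemma equidistributed_ext F H : (forall t, 0 <= t <= 1 -> F t = H t) ->
  equidistributed F -> equidistributed H.
Proof.
move=> FH [[K lipF] cvgF]; split.
  exists K => a c a0 ac c1.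
  by rewrite -!FH ?a0 ?c1 ?(le_trans a0 ac) ?(le_trans ac c1) // lipF.
move=> x x01; rewrite -!FH ?lexx ?ler01 //.
rewrite (_ : (fun n => _) = (fun n => iter n transfer F x)); first exact: cvgF.
by apply/funext => n; apply/esym/(iter_transfer_ext b_gt1).
Qed.

Lemma equidistributed_sum (n : nat) (e : nat -> R) (F : nat -> R -> R) :
  (forall i, equidistributed (F i)) ->
  equidistributed (fun t => \sum_(0 <= i < n) e i * F i t).
Proof.
move=> eqF; elim: n => [|n IH].
  apply: (@equidistributed_ext (fun t => F 0%N t + -1 * F 0%N t)).
    by move=> t _; rewrite big_geq // mulN1r subrr.
  exact: equidistributed_lin.
apply: (@equidistributed_ext (fun t => \sum_(0 <= i < n) e i * F i t + e n * F n t)).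
  by move=> t _; rewrite big_nat_recr.
exact: equidistributed_lin.
Qed.

(* [transfer] preserves the total mass and the order of measures. *)
Lemma equidistributed_approx K F : unit_lipschitz K F ->
  (forall e, 0 < e -> exists2 H, equidistributed H &
    unit_homo (fun t => F t + -1 * H t) /\ (F 1 - F 0) - (H 1 - H 0) <= e) ->
  equidistributed F.
Proof.
move=> lipF approx; split; first by exists K.
move=> x x01; rewrite -cvg_shiftS; apply/cvgrPdist_le => e e0.
(* One third each for the convergence of the iterates of [H], for the iterates of [F - H], and for
   the difference of the two limits. *)
have e3 : 0 < e / 3 by rewrite divr_gt0.
have [H [[K' lipH] cvgH] [homoD massD]] := approx _ e3.
have {}cvgH := cvgH x x01.
have {}cvgH : iter n.+1 transfer H x @[n --> \oo] --> (H 1 - H 0) * G x.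
  by rewrite (cvg_shiftS (fun n => iter n transfer H x)).
near=> n.
have hH : `|(H 1 - H 0) * G x - iter n.+1 transfer H x| <= e / 3.
  by near: n; exact: cvgr_dist_le.
have lipD := unit_lipschitz_lin (-1) lipF lipH.
have homoT := iter_transfer_homo b_gt1 n.+1 lipD homoD.
have massT := iter_transfer_mass b_gt1 n.+1 lipD.
have /andP[x0 x1] := x01.
have lo := homoT 0 x (lexx _) x0 x1; have hi := homoT x 1 x0 x1 (lexx _).
move: lo hi massT; rewrite !iter_transferS0 (iter_transfer_lin b_gt1 _ _ lipF lipH x01) subr0 => lo hi massT.
rewrite massT in hi.
have /andP[G0 G1] := gauss_distr_itv x01.
have D0 : F 0 + -1 * H 0 <= F 1 + -1 * H 1 := homoD 0 1 (lexx _) ler01 (lexx _).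
change (`|(F 1 - F 0) * G x - iter n.+1 transfer F x| <= e).
move: hH lo hi; move: (iter n.+1 _ F x) (iter n.+1 _ H x) => u v.
have DG : 0 <= ((F 1 - F 0) - (H 1 - H 0)) * G x <= (F 1 - F 0) - (H 1 - H 0).
  rewrite mulr_ge0 //=; last by lra.
  by rewrite ler_piMr //; lra.
move: DG; rewrite !ler_norml => /andP[DG1 DG2] /andP[h1 h2] h3 h4.
by apply/andP; split; lra.
Unshelve. all: by end_near. Qed.

(** Distribution function of the density equal to 1 above [a] and 0 below; its square has the
    Lipschitz density [2 * hinge a]. *)
Definition hinge (a x : R) : R := Num.max 0 (x - a).

Lemma hinge_sq_slope a x y : x <= y ->
  2 * hinge a x * (y - x) <= hinge a y ^+ 2 - hinge a x ^+ 2 <= 2 * hinge a y * (y - x).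
Proof.
move=> xy; rewrite /hinge !expr2.
have sq := sqr_ge0 (y - x); rewrite expr2 in sq.
case: (leP 0 (x - a)) => hx; case: (leP 0 (y - a)) => hy; apply/andP; split; try nra.
Qed.

Lemma hinge_homo a x y : x <= y -> hinge a x <= hinge a y.
Proof. by move=> xy; rewrite /hinge; case: (leP 0 (x - a)) => hx; case: (leP 0 (y - a)) => hy; lra. Qed.

Lemma hinge_lip a x y : x <= y -> hinge a y - hinge a x <= y - x.
Proof. by move=> xy; rewrite /hinge; case: (leP 0 (x - a)) => hx; case: (leP 0 (y - a)) => hy; lra. Qed.

Lemma hinge_ge0 a x : 0 <= hinge a x.
Proof. by rewrite /hinge le_max lexx. Qed.

Lemma equidistributed_hinge_sq a : equidistributed (fun t => hinge a t ^+ 2).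
Proof.
apply: (@equidistributed_smooth (2 * hinge a 1) 2) => //.
- move=> x y x0 xy y1; have /andP[lo hi] := hinge_sq_slope a xy.
  have y0 := subr_ge0 x y; rewrite xy in y0.
  have hx := hinge_ge0 a x; have h1 := hinge_homo a y1.
  rewrite ger0_norm; last by rewrite (le_trans _ lo) // !mulr_ge0.
  by rewrite (le_trans hi) // ler_wpM2r // ler_wpM2l.
- move=> x y x0 xy y1; have /andP[lo hi] := hinge_sq_slope a xy.
  rewrite -subr_ge0 (le_trans _ lo) // mulr_ge0 ?subr_ge0 // mulr_ge0 //.
  exact: hinge_ge0.
- move=> x y s t s' t' x0 y1 xs st ty xs' st' ty'.
  have /andP[_ up] := hinge_sq_slope a st.
  have /andP[low _] := hinge_sq_slope a st'.
  have hy := hinge_homo a ty; have hx := hinge_homo a xs'.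
  have xy : x <= y by rewrite (le_trans xs) // (le_trans st).
  have hxy := hinge_lip a xy.
  have d0 : 0 <= t - s by rewrite subr_ge0.
  have d0' : 0 <= t' - s' by rewrite subr_ge0.
  move: (hinge a t ^+ 2 - _) (hinge a t' ^+ 2 - _) up low => u u' up low.
  apply: (le_trans (ler_wpM2r d0' up)).
  have := ler_wpM2r d0 low.
  move: (hinge a t) (hinge a s') (hinge a x) (hinge a y) hy hx hxy => ht hs hx' hy' hy hx hxy.
  have hts : ht <= hs + (y - x) by lra.
  have := ler_wpM2r (mulr_ge0 d0 d0') hts.
  move: (y - x) (t - s) (t' - s') => z d d'; lra.
Qed.

(** The subtracted function has as density the ramp from 0 at [a] to 1 at [a + d], which lies below
    the indicator of [[a, +oo[]. *)
Lemma hinge_ramp_homo a (d : R) x y : 0 < d -> x <= y ->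
  hinge a x - (2 * d)^-1 * (hinge a x ^+ 2 - hinge (a + d) x ^+ 2) <=
  hinge a y - (2 * d)^-1 * (hinge a y ^+ 2 - hinge (a + d) y ^+ 2).
Proof.
move=> d0 xy; have d2 : 0 < 2 * d by rewrite mulr_gt0.
rewrite -(ler_pM2l d2) !mulrBr !(mulrA (2 * d) (2 * d)^-1) !divff ?gt_eqF // !mul1r.
rewrite /hinge !opprD !addrA !expr2.
move: (x - a) (y - a) (lerB xy (lexx a)) => s t st.
case: (leP 0 s) => hs; case: (leP 0 t) => ht; case: (leP 0 (s - d)) => hsd; case: (leP 0 (t - d)) => htd; nra.
Qed.

Lemma hinge_ramp_mass a (d : R) x : 0 < d ->
  0 <= hinge a x - (2 * d)^-1 * (hinge a x ^+ 2 - hinge (a + d) x ^+ 2) <= d.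
Proof.
move=> d0; have d2 : 0 < 2 * d by rewrite mulr_gt0.
rewrite -(pmulr_rge0 _ d2) -(ler_pM2l d2 _ d).
rewrite !mulrBr !(mulrA (2 * d) (2 * d)^-1) !divff ?gt_eqF // !mul1r.
rewrite /hinge !opprD !addrA !expr2.
move: (x - a) => s.
case: (leP 0 s) => hs; case: (leP 0 (s - d)) => hsd; apply/andP; split; nra.
Qed.

Lemma equidistributed_hinge a : equidistributed (hinge a).
Proof.
apply: (@equidistributed_approx 1).
  move=> x y x0 xy y1; rewrite mul1r ger0_norm ?hinge_lip // subr_ge0.
  exact: hinge_homo.
move=> d d0.
exists (fun t => 0 + (2 * d)^-1 * (hinge a t ^+ 2 + -1 * hinge (a + d) t ^+ 2)).
  apply: (@equidistributed_ext (fun t => (hinge a t ^+ 2 + -1 * hinge a t ^+ 2) +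
    (2 * d)^-1 * (hinge a t ^+ 2 + -1 * hinge (a + d) t ^+ 2))).
    by move=> t _; ring.
  do !apply: equidistributed_lin; exact: equidistributed_hinge_sq.
split=> [x y x0 xy y1|].
  by rewrite !mulN1r !add0r; exact: hinge_ramp_homo.
have /andP[_ m1] := hinge_ramp_mass a 1 d0; have /andP[m0 _] := hinge_ramp_mass a 0 d0.
rewrite !mulN1r !add0r; lra.
Qed.

(** For [t >= 0], [min a t = hinge 0 t - hinge a t]. Differences of such functions have interval
    indicators as densities and thus generate step densities. *)
Lemma equidistributed_min a : equidistributed (Num.min a).
Proof.
apply: (@equidistributed_ext (fun t => (hinge 0 t + -1 * hinge a t) +
   0 * hinge 0 t)); last by do !apply: equidistributed_lin; exact: equidistributed_hinge.
move=> t /andP[t0 _]; rewrite mul0r addr0 mulN1r /hinge subr0.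
by case: (leP 0 t); case: (leP 0 (t - a)); case: (leP a t); lra.
Qed.

End Equidistribution.

(** * Riemann sums over uniform partitions *)

Section RiemannStep.
Context {R : realType}.
Implicit Types (f F : R -> R) (N : nat).

Lemma min_increment F (p p' x : R) : p <= p' ->
  F (Num.min p' x) - F (Num.min p x) = F (Num.max p (Num.min p' x)) - F p.
Proof.
move=> pp'; have [xp|px] := leP x p.
  have xp' := le_trans xp pp'.
  by rewrite min_r // max_l // !subrr.
by rewrite max_r // le_min pp' ltW.
Qed.

Lemma sum_min_increment F N (p : nat -> R) x :
  \sum_(0 <= i < N) (F (Num.min (p i.+1) x) - F (Num.min (p i) x)) =
  F (Num.min (p N) x) - F (Num.min (p 0) x).
Proof. by rewrite telescope_sumr. Qed.

Lemma unit_cell N (x : R) : (0 < N)%N -> 0 <= x <= 1 ->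
  exists2 i, (i < N)%N & i%:R / N%:R <= x <= i.+1%:R / N%:R.
Proof.
move=> N0 /andP[x0 x1].
have N0' : 0 < N%:R :> R by rewrite ltr0n.
suff H k : x <= k.+1%:R / N%:R ->
    exists2 i, (i < k.+1)%N & i%:R / N%:R <= x <= i.+1%:R / N%:R.
  by have := H N.-1; rewrite prednK // divff ?gt_eqF // => /(_ x1).
elim: k => [|k IH] xk; first by exists 0%N => //; rewrite mul0r x0.
have [/IH[i ik ix]|kx] := leP x (k.+1%:R / N%:R).
  by exists i => //; exact: ltnW.
by exists k.+1 => //; rewrite (ltW kx).
Qed.

Lemma riemann_uniform f : riemann_integrable 0 1 f ->
  exists l : R, forall e, 0 < e -> exists2 N, (0 < N)%N & forall t : nat -> R,
    (forall i, (i < N)%N -> i%:R / N%:R <= t i <= i.+1%:R / N%:R) ->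
    `|\sum_(0 <= i < N) f (t i) / N%:R - l| < e.
Proof.
move=> [l fl]; exists l => e e0; have [d d0 fd] := fl e e0.
pose N := (Num.truncn d^-1).+1.
have N0 : 0 < N%:R :> R by rewrite ltr0n.
have Nd : N%:R^-1 < d.
  by rewrite invf_plt ?posrE // truncnS_gt.
exists N => // t tP.
have stepE i : i.+1%:R / N%:R - i%:R / N%:R = N%:R^-1 :> R.
  by rewrite -mulrBl -natr1 addrAC subrr add0r mul1r.
have := fd N (fun i => i%:R / N%:R) t (mul0r _) (divff (lt0r_neq0 N0)).
under eq_bigr do rewrite stepE.
apply=> i iN; split; first exact: tP.
by rewrite stepE.
Qed.

(** Moving a single tag from [p j] to [x] changes the sum by [(f x - f (p j)) / N], while both sums
    stay within 1 of the integral. *)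
Lemma riemann_bounded f : riemann_integrable 0 1 f ->
  exists2 B, 0 <= B & forall x, 0 <= x <= 1 -> `|f x| <= B.
Proof.
move=> /riemann_uniform[l fl]; have [N N0 fN] := fl 1 ltr01.
have N0' : 0 < N%:R :> R by rewrite ltr0n.
pose p i : R := i%:R / N%:R.
have pp i : p i <= p i.+1 by rewrite ler_pM2r ?invr_gt0 // ler_nat.
exists (\sum_(0 <= i < N) `|f (p i)| + 2 * N%:R) => [|x x01].
  by rewrite addr_ge0 ?sumr_ge0 // mulr_ge0.
have [j jN xj] := unit_cell N0 x01.
have h1 : `|\sum_(0 <= i < N) f (p i) / N%:R - l| < 1.
  by apply: fN => i iN; rewrite lexx pp.
have h2 : `|\sum_(0 <= i < N) f (if i == j then x else p i) / N%:R - l| < 1.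
  by apply: fN => i iN; case: eqP => [->//|_]; rewrite lexx pp.
have E : \sum_(0 <= i < N) f (if i == j then x else p i) / N%:R =
    \sum_(0 <= i < N) f (p i) / N%:R + (f x - f (p j)) / N%:R.
  rewrite !big_mkord (bigD1 (Ordinal jN)) //= [in RHS](bigD1 (Ordinal jN)) //= eqxx.
  under eq_bigr => i ij.
    have -> : (nat_of_ord i == j) = false by apply/negbTE; move: ij; rewrite -val_eqE.
    over.
  by rewrite mulrBl; ring.
have : `|(f x - f (p j)) / N%:R| < 2.
  rewrite (_ : _ / _ = (\sum_(0 <= i < N) f (if i == j then x else p i) / N%:R - l) -
    (\sum_(0 <= i < N) f (p i) / N%:R - l)); last by rewrite E; ring.
  by rewrite (le_lt_trans (ler_normB _ _)) //; lra.
rewrite normrM (gtr0_norm (_ : 0 < N%:R^-1)) ?invr_gt0 // ltr_pdivrMr // => h3.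
have h4 : `|f (p j)| <= \sum_(0 <= i < N) `|f (p i)|.
  by rewrite big_mkord (bigD1 (Ordinal jN)) //= lerDl sumr_ge0.
rewrite -[f x](subrK (f (p j))) (le_trans (ler_normD _ _)) // addrC lerD //.
exact: ltW.
Qed.

End RiemannStep.

(** * Regularity of the distribution function under each hypothesis on [f] *)

Section DistributionFunction.
Context {R : realType} (mu : probability (measurableTypeR R) R).
Hypothesis mu_I : mu [set` `[(0 : R), 1]] = 1%E.
Hypothesis mu_ac : mu `<< @lebesgue_measure R.
Variable f : R -> R.
Hypothesis f_deriv : distr_deriv mu f.
Local Notation F := (distr_fun mu).

Lemma distr_fun1 : F 1 = 1.
Proof. by rewrite /distr_fun mu_I. Qed.

Lemma distr_fun_homo : unit_homo F.
Proof.
by move=> a c a0 ac c1; rewrite -subr_ge0 -lee_fin -distr_funB.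
Qed.

Lemma distr_fun_lipschitz B : (forall x, 0 <= x <= 1 -> `|f x| <= B) ->
  unit_lipschitz B F.
Proof.
move=> fB a c a0 ac c1; rewrite ger0_norm ?subr_ge0 ?distr_fun_homo //.
have fB' x : a <= x <= c -> - B <= f x <= B.
  move=> /andP[ax xc]; rewrite -ler_norml; apply: fB.
  by rewrite (le_trans a0) // (le_trans xc).
by have /andP[] := distr_fun_slope mu_ac f_deriv a0 ac c1 fB'.
Qed.

(** Both mean slopes lie within [L * (y - x)] of [f x], whence the factor 2. *)
Lemma distr_fun_smooth L :
  (forall x y, 0 <= x -> x <= y -> y <= 1 -> `|f x - f y| <= L * (y - x)) ->
  unit_smooth (2 * L) F.
Proof.
move=> fL x y a c a' c' x0 y1 xa ac cy xa' ac' cy'.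
have xy : x <= y by rewrite (le_trans xa) // (le_trans ac).
have near_fx t : x <= t <= y -> f x - L * (y - x) <= f t <= f x + L * (y - x).
  move=> /andP[xt ty]; have /ler_normlP[h1 h2] := fL x t x0 xt (le_trans ty y1).
  have L0 : 0 <= L.
    have := fL 0 1 (lexx _) ler01 (lexx _); rewrite subr0 mulr1.
    exact: le_trans.
  have : L * (t - x) <= L * (y - x) by rewrite ler_wpM2l // lerB.
  by move=> h3; apply/andP; split; lra.
have slope s t : x <= s -> s <= t -> t <= y ->
   (f x - L * (y - x)) * (t - s) <= F t - F s <= (f x + L * (y - x)) * (t - s).
  move=> xs st ty; apply: (distr_fun_slope mu_ac f_deriv (le_trans x0 xs) st (le_trans ty y1)).
  by move=> z /andP[sz zt]; apply: near_fx; rewrite (le_trans xs) // (le_trans zt).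
have /andP[_ up] := slope a c xa ac cy.
have /andP[low _] := slope a' c' xa' ac' cy'.
have d0 : 0 <= c - a by rewrite subr_ge0.
have d0' : 0 <= c' - a' by rewrite subr_ge0.
have := ler_wpM2r d0' up; have := ler_wpM2r d0 low.
move: (F c - F a) (F c' - F a') (c - a) (c' - a') (y - x) => *; lra.
Qed.

(** Let [H] have as density the lower step function of [f], with value the infimum [k i] on each
    cell. Then [F - H] is nondecreasing, and its mass is bounded by comparing two tagged Riemann
    sums. *)
Lemma distr_fun_equidistributed (b : R) (N : nat) : 1 < b -> b <= N.+1%:R ->
  riemann_integrable 0 1 f -> equidistributed b F.
Proof.
move=> b_gt1 bN fR; have [B B0 fB] := riemann_bounded fR.
apply: (equidistributed_approx b_gt1 (distr_fun_lipschitz fB)) => e e0.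
have e4 : 0 < e / 4 by rewrite divr_gt0.
have [l fl] := riemann_uniform fR; have [n n0 fn] := fl _ e4.
have n0' : 0 < n%:R :> R by rewrite ltr0n.
pose p i : R := i%:R / n%:R.
have pp i : p i <= p i.+1 by rewrite ler_pM2r ?invr_gt0 // ler_nat.
have p0 i : 0 <= p i by rewrite divr_ge0.
have p1 i : (i < n)%N -> p i.+1 <= 1 by move=> ni; rewrite ler_pdivrMr // mul1r ler_nat.
have stepE i : p i.+1 - p i = n%:R^-1.
  by rewrite -mulrBl -natr1 addrAC subrr add0r mul1r.
pose E i := [set f t | t in [set t | p i <= t <= p i.+1]].
pose k i := inf (E i).
have fB' i t : (i < n)%N -> p i <= t <= p i.+1 -> - B <= f t <= B.
  move=> ni /andP[pt tp]; rewrite -ler_norml fB // (le_trans (p0 i)) //.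
  by rewrite (le_trans tp) // p1.
have hasE i : (i < n)%N -> has_inf (E i).
  move=> ni; split; first by exists (f (p i)), (p i) => //=; rewrite lexx pp.
  by exists (- B) => _ [t ti <-]; have /andP[] := fB' i t ni ti.
have kf i t : (i < n)%N -> p i <= t <= p i.+1 -> k i <= f t.
  by move=> ni ti; apply: ge_inf; [have [] := hasE i ni|exists t].
pose clamp i x := Num.max (p i) (Num.min (p i.+1) x).
have clampP i x : p i <= clamp i x <= p i.+1.
  by rewrite le_max lexx /= ge_max pp ge_min lexx.
have clamp_homo i a c : a <= c -> clamp i a <= clamp i c.
  by move=> ac; rewrite /clamp le_max2 // le_min2.
pose H t := \sum_(0 <= i < n) k i * (Num.min (p i.+1) t + -1 * Num.min (p i) t).
(* [clamp i] projects onto the cell [i], so increments of [F - H] split into contributions of single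
   cells. *)
have splitD a c : 0 <= a <= 1 -> 0 <= c <= 1 -> (F c - F a) - (H c - H a) =
    \sum_(0 <= i < n) ((F (clamp i c) - F (clamp i a)) - k i * (clamp i c - clamp i a)).
  have FE x : 0 <= x <= 1 -> F x - F 0 = \sum_(0 <= i < n) (F (clamp i x) - F (p i)).
    move=> /andP[x0 x1]; under eq_bigr do rewrite -(min_increment F x (pp _)).
    rewrite (sum_min_increment F n p x) /p divff ?gt_eqF // mul0r.
    by rewrite min_r // min_l.
  have HE x : H x = \sum_(0 <= i < n) k i * (clamp i x - p i).
    apply: eq_bigr => i _; rewrite -(min_increment id x (pp i)) /=; ring.
  move=> a01 c01; rewrite (_ : F c - F a = (F c - F 0) - (F a - F 0)); last by ring.
  rewrite !FE // !HE -!sumrB; apply: eq_bigr => i _; ring.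
exists H.
  apply: (equidistributed_sum b_gt1) => i; apply: (equidistributed_lin b_gt1);
    exact: (equidistributed_min b_gt1 bN).
split=> [a c a0 ac c1|].
  rewrite -subr_ge0.
  have -> : F c + -1 * H c - (F a + -1 * H a) = (F c - F a) - (H c - H a) by ring.
  rewrite splitD ?a0 ?c1 ?(le_trans a0 ac) ?(le_trans ac c1) // big_nat sumr_ge0 // => i /= ni.
  have /andP[pa _] := clampP i a; have /andP[_ cp] := clampP i c.
  have kfB t : clamp i a <= t <= clamp i c -> k i <= f t <= B.
    move=> /andP[lo hi]; have ti : p i <= t <= p i.+1.
      by rewrite (le_trans pa) //= (le_trans hi).
    by rewrite kf //=; have /andP[] := fB' i t ni ti.
  rewrite subr_ge0.
  by have /andP[] := distr_fun_slope mu_ac f_deriv (le_trans (p0 i) pa)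
    (clamp_homo i a c ac) (le_trans cp (p1 i ni)) kfB.
have exT i : exists t, (i < n)%N -> p i <= t <= p i.+1 /\ f t < k i + e / 4.
  have [ni|_] := ltnP i n; last by exists 0.
  have [_ [t ti <-] ft] := inf_adherent e4 (hasE i ni).
  by exists t.
(* If no tag worked, [f] would stay below the mean slope minus [e / 4] on the whole cell,
   contradicting [distr_fun_slope]. Out of range, 0 is a default for [choice]. *)
have exS i : exists s, (i < n)%N ->
    p i <= s <= p i.+1 /\ F (p i.+1) - F (p i) <= (f s + e / 4) / n%:R.
  have [ni|_] := ltnP i n; last by exists 0.
  apply: contrapT => noS.
  pose v := (F (p i.+1) - F (p i)) * n%:R - e / 4.
  have fv z : p i <= z <= p i.+1 -> - B <= f z <= v.
    move=> zi; have /andP[-> _] /= := fB' i z ni zi.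
    rewrite leNgt; apply/negP => vf; apply: noS; exists z => _; split=> //.
    by rewrite ler_pdivlMr //; rewrite /v in vf; lra.
  have /andP[_] := distr_fun_slope mu_ac f_deriv (p0 i) (pp i) (p1 i ni) fv.
  by rewrite stepE ler_pdivlMr // /v; lra.
have [t tP] := choice exT; have [s sP] := choice exS.
have ht : `|\sum_(0 <= i < n) f (t i) / n%:R - l| < e / 4 by apply: fn => i /tP[].
have hs : `|\sum_(0 <= i < n) f (s i) / n%:R - l| < e / 4 by apply: fn => i /sP[].
have sumc (r : R) : \sum_(0 <= i < n) r / n%:R = r.
  by rewrite big_mkord sumr_const card_ord -[LHS]mulr_natr divfK // gt_eqF.
rewrite splitD ?lexx ?ler01 //.
(* The tags [s] bound the mass of [F] from above and the tags [t] that of [H] from below, with an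
   error [e / 2] in all; the two sums differ by less than another [e / 2]. *)
apply: (@le_trans _ _ (\sum_(0 <= i < n) (f (s i) / n%:R - f (t i) / n%:R + (e / 2) / n%:R))).
  apply: ler_sum_nat => i /= ni.
  have c1 : clamp i 1 = p i.+1 by rewrite /clamp min_l ?p1 // max_r.
  have c0 : clamp i 0 = p i by rewrite /clamp min_r // max_l.
  rewrite c1 c0 stepE; have [_ h1] := sP i ni; have [_ h2] := tP i ni.
  have ni0 : 0 < n%:R^-1 :> R by rewrite invr_gt0.
  have := ler_wpM2r (ltW ni0) (ltW h2); move: h1.
  move: (F _ - F _) (n%:R^-1) => *; lra.
rewrite big_split /= sumc sumrB.
by move: ht hs => /ltr_normlP[h1 h2] /ltr_normlP[h3 h4]; lra.
Qed.

End DistributionFunction.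

(** * The limit law and its exponential rate *)

Lemma gauss_distrE {R : realType} (m : nat) (x : R) : (2 <= m)%N ->
  cf_const m / (m%:R - 1) ^+ 2
    * ln (m%:R * ((m%:R - 1) * x + 1) / ((m%:R - 1) * x + m%:R)) = gauss_distr m%:R x.
Proof.
move=> m_ge2; rewrite /cf_const /gauss_distr.
have m1 : (m%:R - 1) ^+ 2 != 0 :> R.
  by rewrite expf_neq0 // gt_eqF // subr_gt0 ltr1n.
by rewrite [X in X * _]mulrAC divff // mul1r mulrC.
Qed.

Theorem theorem5p1 (R : realType) (m : nat) (m_ge2 : (2 <= m)%N)
    (mu : probability (measurableTypeR R) R) (mu_I : mu [set` `[0%R, 1%R]] = 1%E)
    (mu_ac : mu `<< @lebesgue_measure R)
    (f : R -> R) (f_deriv : distr_deriv mu f) :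
  (riemann_integrable 0 1 f ->
     forall x : R, x \in `[0, 1] ->
       mu (cf_event m n x) @[n --> \oo] --> 
         (cf_const m / (m%:R - 1) ^+ 2
          * ln (m%:R * ((m%:R - 1) * x + 1) / ((m%:R - 1) * x + m%:R)))%:E)
  /\
  ([lipschitz f x | x in [set` `[0, 1]] : set R] ->
     exists q k : R, [/\ 0 < q, q < 1, 0 < k &
       forall (x : R) (n : nat), x \in `[0, 1] -> (0 < n)%N ->
         exists2 theta : R, `|theta| <= k &
           mu (cf_event m n x) =
             (cf_const m / (m%:R - 1) ^+ 2 * (1 + theta * q ^+ n)
              * ln (m%:R * ((m%:R - 1) * x + 1) / ((m%:R - 1) * x + m%:R)))%:E]).
Proof.
have b_gt1 := @base_gt1 R m m_ge2.
have bN : m%:R <= m.+1%:R :> R by rewrite ler_nat.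
have mass : distr_fun mu 1 - distr_fun mu 0 = 1.
  (* The value at 0 is the mass of the point 0; it equals the measure of the strict event, which is
     empty. *)
  rewrite (distr_fun1 mu_I) -(cf_distr0 m_ge2 mu_ac) ?lexx ?ler01 //.
  rewrite /cf_distr (_ : cf_event m 0 0 = set0) ?measure0 ?subr0 //.
  apply/seteqP; split=> // t [/=]; rewrite in_itv /= => /andP[t0 _].
  by rewrite ltNge t0.
have iterE n x : 0 <= x <= 1 ->
    cf_distr m mu n x = iter n (transfer m%:R) (distr_fun mu) x.
  move=> x01; rewrite (cf_distr_iter m_ge2 mu_ac n x01).
  by apply: (iter_transfer_ext b_gt1) => // t; exact: cf_distr0.
split=> [fR x|fL].
  rewrite in_itv /= => x01; rewrite gauss_distrE //.
  have [_ cvgF] := distr_fun_equidistributed mu_ac f_deriv b_gt1 bN fR.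
  under eq_cvg => n do rewrite mu_cf_event iterE //.
  apply: cvg_EFin; first by near=> n.
  by have := cvgF x x01; rewrite mass mul1r.
have [L L0 fL'] : exists2 L : R, 0 < L & forall x y, 0 <= x -> x <= y -> y <= 1 ->
    `|f x - f y| <= L * (y - x).
  have [L [L0 HL]] := pinfty_ex_gt0 fL; exists L => // x y x0 xy y1.
  have := HL (x, y); rewrite /= distrC (distrC x).
  rewrite (ger0_norm (_ : 0 <= y - x)) ?subr_ge0 // distrC; apply.
  by split; rewrite /= in_itv /= ?x0 ?y1 ?(le_trans xy) ?(le_trans x0).
have fB x : 0 <= x <= 1 -> `|f x| <= `|f 0| + L.
  move=> /andP[x0 x1]; rewrite -[f x](subKr (f 0)) (le_trans (ler_normB _ _)) //.
  rewrite lerD2l (le_trans (fL' _ _ (lexx _) x0 x1)) // subr0.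
  by rewrite ler_piMr // ltW.
have L2 : 0 <= 2 * L by rewrite mulr_ge0 // ltW.
have [C C0 bound] := iter_transfer_smooth b_gt1 bN (gauss_distr_cone b_gt1)
  (gauss_mass b_gt1) (transfer_gauss b_gt1) L2 (distr_fun_lipschitz mu_ac f_deriv fB)
  (@distr_fun_homo _ mu) (distr_fun_smooth mu_ac f_deriv fL').
set q := 1 - _ in bound.
have q01 : 0 < q < 1.
  have g0 := gap_gt0 b_gt1 (m * 3 + 2); have g1 := gap_lt1 b_gt1 (m * 3 + 2).
  by apply/andP; split; rewrite /q; lra.
have /andP[q0 q1] := q01.
exists q, C; split=> // x n; rewrite in_itv /= => x01 n0.
have := bound n x x01; rewrite mass mul1r.
rewrite -(prednK n0) iter_transferS0 subr0 (prednK n0) => bnd.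
rewrite mu_cf_event iterE //.
have qn0 : 0 < q ^+ n by rewrite exprn_gt0.
have /andP[G0 _] := gauss_distr_itv b_gt1 x01.
(* Where the limit law vanishes, the relative bound forces the iterate to vanish and [theta = 0]
   serves; elsewhere [theta] is the relative error divided by [q ^+ n]. *)
move: G0; rewrite le_eqVlt => /orP[/eqP G0|G0].
  exists 0; first by rewrite normr0 ltW.
  rewrite mul0r addr0 mulr1 gauss_distrE // -G0; congr (_%:E).
  by move: bnd; rewrite -G0 subr0 mulr0 normr_le0 => /eqP.
set u := iter n _ _ x in bnd *.
exists ((u - gauss_distr m%:R x) / gauss_distr m%:R x / q ^+ n).
  rewrite normrM normrM !normfV (gtr0_norm G0) (gtr0_norm qn0).
  by rewrite ler_pdivrMr // ler_pdivrMr.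
rewrite divfK ?gt_eqF // mulrAC gauss_distrE //; congr (_%:E).
by field; rewrite gt_eqF.
Unshelve. all: by end_near. Qed.
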